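(* Let $0<M<\frac{1}{2(\ln 4-1)}$ and let $f=h+\overline{g}\in\mathcal{P}^{0}_{\mathcal{H}}(M)$ with $$f(z)=z+\sum_{n=2}^{\infty}a_nz^n+\overline{\sum_{n=2}^{\infty}b_nz^n},\qquad z\in\mathbb{D}.$$ Then $$|z|+|f(z)|+\sum_{n=2}^{\infty}(|a_n|+|b_n|)|z|^n\leq d\left(f(0),\partial f(\mathbb{D})\right)$$ for all $|z|=r\leq r_{M}$, where $r_{M}$ is the unique root in $(0,1)$ of the equation $$2r+4M\left(r+(1-r)\log(1-r)\right)-1-2M(1-2\log 2)=0.$$ The radius $r_M$ is the best possible.
   Context: $\mathbb{D}=\{z\in\mathbb{C}:|z|<1\}$. $\mathcal{H}_0$ denotes the class of complex-valued harmonic mappings $f=h+\overline{g}$ on $\mathbb{D}$, with $h,g$ analytic in $\mathbb{D}$, normalized by $h(0)=0$, $h'(0)=1$, $g(0)=0$, $g'(0)=0$. For $M>0$, $$\mathcal{P}^{0}_{\mathcal{H}}(M)=\{f=h+\overline{g}\in\mathcal{H}_0:\ \operatorname{Re}(zh''(z))>-M+|zg''(z)|\ \text{for all } z\in\mathbb{D}\}.$$ $d(f(0),\partial f(\mathbb{D}))$ denotes the Euclidean distance from $f(0)$ to the boundary of $f(\mathbb{D})$, i.e. $\liminf_{|z|\to 1}|f(z)-f(0)|$. ''Best possible'' means the radius cannot be replaced by any larger number (the extremal function being $f_M(z)=z+2M\sum_{n\ge2}\frac{z^n}{n(n-1)}$). *)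

(* Defs.v *)
From Stdlib Require Import Reals.
From Coquelicot Require Import Coquelicot.
Open Scope R_scope.

Definition harm (h g : C -> C) : C -> C := fun z => (h z + Cconj (g z))%C.

Definition in_PH0 (M : R) (h g : C -> C) : Prop :=
  exists h' h'' g' g'' : C -> C,
    (forall z : C, Cmod z < 1 ->
        is_derive (K := C_AbsRing) (V := C_NormedModule) h z (h' z) /\
        is_derive (K := C_AbsRing) (V := C_NormedModule) h' z (h'' z) /\
        is_derive (K := C_AbsRing) (V := C_NormedModule) g z (g' z) /\
        is_derive (K := C_AbsRing) (V := C_NormedModule) g' z (g'' z)) /\
    h (RtoC 0) = RtoC 0 /\ h' (RtoC 0) = RtoC 1 /\
    g (RtoC 0) = RtoC 0 /\ g' (RtoC 0) = RtoC 0 /\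
    (forall z : C, Cmod z < 1 ->
        Re (z * h'' z)%C > - M + Cmod (z * g'' z)%C).

Definition taylor_coeffs (h : C -> C) (a : nat -> C) : Prop :=
  forall z : C, Cmod z < 1 ->
    is_series (K := C_AbsRing) (V := C_NormedModule)
              (fun n => (a n * Cpow z n)%C) (h z).

(* d(f(0), boundary f(D)) := liminf_{|z| -> 1^-} |f(z) - f(0)|
   = sup { m | exists r < 1, forall z, r < |z| < 1 -> m <= |f z - f 0| } *)
Definition dist_bd (f : C -> C) : Rbar :=
  Lub_Rbar (fun m => exists r : R, r < 1 /\
     forall z : C, r < Cmod z < 1 -> m <= Cmod (f z - f (RtoC 0))%C).

Definition bohr_ineq (f : C -> C) (a b : nat -> C) (z : C) : Prop :=
  ex_series (fun n => (Cmod (a (n + 2)%nat) + Cmod (b (n + 2)%nat)) * Cmod z ^ (n + 2)) /\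
  Rbar_le (Finite (Cmod z + Cmod (f z) +
     Series (fun n => (Cmod (a (n + 2)%nat) + Cmod (b (n + 2)%nat)) * Cmod z ^ (n + 2))))
    (dist_bd f).

Definition rM_eq (M r : R) : R :=
  2 * r + 4 * M * (r + (1 - r) * ln (1 - r)) - 1 - 2 * M * (1 - 2 * ln 2).

(* Main.v *)
(* For a unimodular e put F = h + e g = z + sum c_n z^n.  Then Re (z F'') > - M, and the
   coefficients d_m = m (m + 1) c_(m+1) of z F'' satisfy Caratheodory's bound |d_m| <= 2 M and
   Harnack's bound Re (z F'') >= - 2 M |z| / (1 + |z|).  Both come from integrating truncations
   of Re (z F'') on a circle against nonnegative cosine polynomials, 1 +- cos and truncated
   Poisson kernels minus their minima.  Choosing e so that |a_n + e b_n| = |a_n| + |b_n| gives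
   |a_n| + |b_n| <= 2 M / (n (n - 1)).  Choosing e with e g(z) = conj (g(z)) gives |f| = |F| at z;
   integrating Harnack's bound twice along the ray through z then yields
   |f(z)| >= |z| - 2 M ((1 + |z|) ln (1 + |z|) - |z|).  The right-hand side need not be monotone
   in |z|, but its limit 1 + 2 M (1 - 2 ln 2) bounds the liminf defining the distance, and the
   equation for r_M says exactly that the majorant of the left-hand side equals this limit.
   All bounds are attained by f_M, on the positive axis for the coefficients and on the
   negative axis for the distance. *)

Require Import Defs.
From Stdlib Require Import Reals Ranalysis5 Lra Lia.
From Coquelicot Require Import Coquelicot.
Open Scope R_scope.

(** * Nonnegative cosine polynomials *)

Lemma is_RInt_cos_period (p : R) (c : R) :
  p <> 0 -> sin (p * (2 * PI)) = 0 ->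
  is_RInt (fun x => c * cos (p * x)) 0 (2 * PI) 0.
Proof.
  intros Hp Hs.
  replace 0 with (minus (c * (sin (p * (2 * PI)) / p)) (c * (sin (p * 0) / p))) at 2.
  - apply (is_RInt_derive (fun x => c * (sin (p * x) / p))).
    + intros x _. auto_derive; [exact I|]. now field.
    + intros x _. apply (ex_derive_continuous (V := R_NormedModule)). auto_derive. exact I.
  - rewrite Hs, Rmult_0_r, sin_0. unfold minus, plus, opp; simpl. field; exact Hp.
Qed.

Lemma sin_INR_2PI (n : nat) : sin (INR n * (2 * PI)) = 0.
Proof.
  induction n as [|n IH].
  - simpl. rewrite Rmult_0_l. apply sin_0.
  - rewrite S_INR. replace ((INR n + 1) * (2 * PI)) with (INR n * (2 * PI) + 2 * PI) by ring.
    rewrite sin_plus, IH, sin_2PI. ring.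
Qed.

(** The integral of cos (m t) cos (j t) over a period is [PI * pairing m j]. The second summand
    gives the constant mode double weight: the value at m = j = 0 is 2. *)
Definition pairing (m j : nat) : R :=
  (if Nat.eqb m j then 1 else 0) + (if Nat.eqb (m + j) 0 then 1 else 0).

Lemma is_RInt_cos_INR_plus (c : R) (m j : nat) :
  is_RInt (fun t => c * cos ((INR m + INR j) * t)) 0 (2 * PI)
          (c * (2 * PI) * (if Nat.eqb (m + j) 0 then 1 else 0)).
Proof.
  destruct (Nat.eqb_spec (m + j) 0) as [E|E].
  - assert (m = 0%nat) by lia. assert (j = 0%nat) by lia. subst.
    apply is_RInt_ext with (fun _ => c).
    + intros t _. simpl. rewrite Rplus_0_l, Rmult_0_l, cos_0. ring.
    + replace (c * (2 * PI) * 1) with ((2 * PI - 0) * c) by ring.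
      exact (is_RInt_const (V := R_NormedModule) 0 (2 * PI) c).
  - rewrite Rmult_0_r. apply is_RInt_cos_period.
    + rewrite <- plus_INR. now apply not_0_INR.
    + rewrite <- plus_INR. apply sin_INR_2PI.
Qed.

Lemma is_RInt_cos_INR_minus (c : R) (m j : nat) :
  is_RInt (fun t => c * cos ((INR m - INR j) * t)) 0 (2 * PI)
          (c * (2 * PI) * (if Nat.eqb m j then 1 else 0)).
Proof.
  destruct (Nat.eqb_spec m j) as [E|E].
  - subst. apply is_RInt_ext with (fun _ => c).
    + intros t _. simpl. rewrite Rminus_diag, Rmult_0_l, cos_0. ring.
    + replace (c * (2 * PI) * 1) with ((2 * PI - 0) * c) by ring.
      exact (is_RInt_const (V := R_NormedModule) 0 (2 * PI) c).
  - rewrite Rmult_0_r. apply is_RInt_cos_period.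
    + intro H. apply E, INR_eq. lra.
    + replace ((INR m - INR j) * (2 * PI)) with (INR m * (2 * PI) - INR j * (2 * PI)) by ring.
      rewrite sin_minus, !sin_INR_2PI. ring.
Qed.

Lemma is_RInt_cos_cos (c : R) (m j : nat) :
  is_RInt (fun t => c * (cos (INR m * t) * cos (INR j * t))) 0 (2 * PI)
          (c * PI * pairing m j).
Proof.
  apply is_RInt_ext with
    (fun t => plus (c / 2 * cos ((INR m - INR j) * t)) (c / 2 * cos ((INR m + INR j) * t))).
  - intros t _. unfold plus; simpl.
    rewrite Rmult_minus_distr_r, Rmult_plus_distr_r, cos_minus, cos_plus. field.
  - replace (c * PI * pairing m j) with
      (c / 2 * (2 * PI) * (if Nat.eqb m j then 1 else 0) +
            c / 2 * (2 * PI) * (if Nat.eqb (m + j) 0 then 1 else 0))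
      by (unfold pairing; field).
    apply (is_RInt_plus (V := R_NormedModule)).
    + apply is_RInt_cos_INR_minus.
    + apply is_RInt_cos_INR_plus.
Qed.

Lemma is_RInt_sum_f_R0 (f : nat -> R -> R) (v : nat -> R) (a b : R) (K : nat) :
  (forall k, is_RInt (f k) a b (v k)) ->
  is_RInt (fun t => sum_f_R0 (fun k => f k t) K) a b (sum_f_R0 v K).
Proof.
  intros H. induction K as [|K IH]; simpl; [apply H|].
  apply (is_RInt_plus (V := R_NormedModule)); [exact IH | apply H].
Qed.

Lemma sum_pairing (p : nat -> R) (m K : nat) :
  sum_f_R0 (fun j => p j * pairing m j) K =
  (if Nat.leb m K then p m else 0) + (if Nat.eqb m 0 then p 0%nat else 0).
Proof.
  induction K as [|K IH].
  - simpl. unfold pairing. destruct m; simpl; ring.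
  - simpl sum_f_R0. rewrite IH. unfold pairing.
    replace (Nat.eqb (m + S K) 0) with false by (symmetry; apply Nat.eqb_neq; lia).
    destruct (Nat.leb_spec m K); destruct (Nat.leb_spec m (S K));
      destruct (Nat.eqb_spec m (S K)); try lia; try subst; ring.
Qed.

(* Integrate the product over a period: only the diagonal terms survive. *)
Lemma cos_poly_pairing_nonneg (x p : nat -> R) (K : nat) :
  (forall t, 0 <= sum_f_R0 (fun m => x m * cos (INR m * t)) K) ->
  (forall t, 0 <= sum_f_R0 (fun j => p j * cos (INR j * t)) K) ->
  0 <= x 0%nat * p 0%nat + sum_f_R0 (fun m => x m * p m) K.
Proof.
  intros Hx Hp.
  set (v := fun m => sum_f_R0 (fun j => x m * p j * PI * pairing m j) K).
  assert (HI : is_RInt (fun t => sum_f_R0 (fun m => x m * cos (INR m * t)) K *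
                                 sum_f_R0 (fun j => p j * cos (INR j * t)) K)
                       0 (2 * PI) (sum_f_R0 v K)).
  { apply is_RInt_ext with (fun t => sum_f_R0 (fun m => sum_f_R0 (fun j =>
        x m * p j * (cos (INR m * t) * cos (INR j * t))) K) K).
    - intros t _. symmetry. rewrite Rmult_comm, scal_sum. apply sum_eq. intros m _.
      rewrite scal_sum. apply sum_eq. intros; ring.
    - apply is_RInt_sum_f_R0. intros m. apply is_RInt_sum_f_R0. intros j.
      apply is_RInt_cos_cos. }
  assert (Hpi := PI_RGT_0).
  assert (H0 : 0 <= sum_f_R0 v K).
  { eapply is_RInt_ge_0; [|exact HI|]; [lra|].
    intros t _. apply Rmult_le_pos; auto. }
  assert (Hv : forall m, (m <= K)%nat ->
            v m = (x m * p m + (if Nat.eqb m 0 then x 0%nat * p 0%nat else 0)) * PI).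
  { intros m Hm. unfold v.
    rewrite (sum_eq _ (fun j => p j * pairing m j * (x m * PI))) by (intros; ring).
    rewrite <- scal_sum, sum_pairing.
    apply Nat.leb_le in Hm. rewrite Hm.
    destruct (Nat.eqb_spec m 0); subst; ring. }
  rewrite (sum_eq _ _ _ Hv), <- scal_sum, plus_sum in H0.
  assert (Hd : sum_f_R0 (fun m => if Nat.eqb m 0 then x 0%nat * p 0%nat else 0) K
               = x 0%nat * p 0%nat).
  { clear. induction K as [|K IH]; simpl; [reflexivity|]. rewrite IH. ring. }
  rewrite Hd in H0.
  apply Rmult_le_reg_l with PI; [exact Hpi|]. lra.
Qed.

(** Multiplying by the denominator of the Poisson kernel makes the sum telescope, by the recurrence
    cos ((n + 1) t) = 2 cos t cos (n t) - cos ((n - 1) t); two boundary terms remain. The - 1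
    corrects the term m = 0, which the sum counts as 2. *)
Lemma poisson_kernel_sum (x t : R) (K : nat) :
  (1 - 2 * x * cos t + x ^ 2) *
    (sum_f_R0 (fun m => 2 * x ^ m * cos (INR m * t)) K - 1) =
  1 - x ^ 2 - 2 * x ^ (K + 1) * cos (INR (K + 1) * t) + 2 * x ^ (K + 2) * cos (INR K * t).
Proof.
  induction K as [|K IH].
  - simpl. rewrite Rmult_0_l, cos_0, Rmult_1_l. ring.
  - simpl sum_f_R0.
    match goal with |- ?D * (?s + ?e - 1) = _ =>
      transitivity (D * (s - 1) + D * e); [ring|] end.
    rewrite IH.
    replace (S K + 1)%nat with (S (S K)) by lia. replace (S K + 2)%nat with (S (S (S K))) by lia.
    replace (K + 1)%nat with (S K) by lia. replace (K + 2)%nat with (S (S K)) by lia.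
    assert (E : cos (INR (S (S K)) * t) = 2 * cos t * cos (INR (S K) * t) - cos (INR K * t)).
    { rewrite !S_INR.
      replace ((INR K + 1 + 1) * t) with ((INR K + 1) * t + t) by ring.
      replace (INR K * t) with ((INR K + 1) * t - t) by ring.
      rewrite cos_plus, cos_minus. ring. }
    rewrite E. simpl. ring.
Qed.

(** The full kernel (1 - x^2) / D is smallest where D is largest, D = (1 + x)^2, which gives (1 - x)
    / (1 + x). The boundary terms of the truncation are at most 4 x^K in size, and D is at least (1
    - x)^2. *)
Lemma poisson_kernel_lower (x t : R) (K : nat) : 0 <= x < 1 ->
  (1 - x) / (1 + x) - 4 * x ^ K / (1 - x) ^ 2 <=
  sum_f_R0 (fun m => 2 * x ^ m * cos (INR m * t)) K - 1.
Proof.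
  intros Hx. set (s := sum_f_R0 _ K - 1).
  assert (E := poisson_kernel_sum x t K). fold s in E.
  set (D := 1 - 2 * x * cos t + x ^ 2) in *.
  assert (Hc := COS_bound t).
  assert (HDl : (1 - x) ^ 2 <= D) by (unfold D; nra).
  assert (HDu : D <= (1 + x) ^ 2) by (unfold D; nra).
  assert (Hl2 : 0 < (1 - x) ^ 2) by (apply pow_lt; lra).
  assert (HxK : 0 <= x ^ K) by (apply pow_le; lra).
  assert (Hr : 1 - x ^ 2 - 4 * x ^ K <= D * s).
  { rewrite E, !pow_add.
    assert (H1 := COS_bound (INR (K + 1) * t)). assert (H2 := COS_bound (INR K * t)).
    assert (x ^ K * x ^ 1 * cos (INR (K + 1) * t) <= x ^ K).
    { simpl. rewrite Rmult_1_r. assert (0 <= x ^ K * x <= x ^ K) by nra. nra. }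
    assert (- x ^ K <= x ^ K * x ^ 2 * cos (INR K * t)).
    { assert (0 <= x ^ 2 <= 1) by (simpl; nra).
      assert (0 <= x ^ K * x ^ 2 <= x ^ K) by nra. nra. }
    lra. }
  assert (H1 : D * ((1 - x) / (1 + x)) <= 1 - x ^ 2).
  { replace (1 - x ^ 2) with ((1 + x) ^ 2 * ((1 - x) / (1 + x))) by (field; lra).
    apply Rmult_le_compat_r; [|exact HDu]. apply Rdiv_le_0_compat; lra. }
  assert (H2 : 4 * x ^ K <= D * (4 * x ^ K / (1 - x) ^ 2)).
  { replace (4 * x ^ K) with ((1 - x) ^ 2 * (4 * x ^ K / (1 - x) ^ 2)) at 1
      by (field; lra).
    apply Rmult_le_compat_r; [|exact HDl]. apply Rdiv_le_0_compat; lra. }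
  apply Rmult_le_reg_l with D; [lra|]. lra.
Qed.

(** * Coefficient and Harnack bounds for power series with real part bounded below *)

Lemma sum_indicator (f : nat -> R) (m K : nat) : (m <= K)%nat ->
  sum_f_R0 (fun j => if Nat.eqb j m then f j else 0) K = f m.
Proof.
  assert (H0 : forall K, (K < m)%nat ->
                 sum_f_R0 (fun j => if Nat.eqb j m then f j else 0) K = 0).
  { intros L. induction L as [|L IH]; intros HL; simpl.
    - destruct m; [lia|reflexivity].
    - rewrite IH by lia. replace (match m with 0%nat => false | S m' => Nat.eqb L m' end) with false.
      + ring.
      + destruct m; [reflexivity|]. symmetry. apply Nat.eqb_neq. lia. }
  induction K as [|K IH]; intros HK.
  - assert (m = 0%nat) by lia. subst. reflexivity.
  - rewrite tech5. destruct (Nat.eqb_spec (S K) m) as [E|E].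
    + subst. rewrite H0 by lia. ring.
    + rewrite IH by lia. ring.
Qed.

Lemma sum_le_Series (b : nat -> R) (K : nat) :
  ex_series b -> (forall n, 0 <= b n) -> sum_f_R0 b K <= Series b.
Proof.
  intros Hb Hp. rewrite <- sum_n_Reals.
  apply (is_lim_seq_incr_compare (sum_n b)).
  - apply (Series_correct _ Hb).
  - intros n. rewrite sum_Sn. unfold plus; simpl. specialize (Hp (S n)). lra.
Qed.

(** The terms [b n - a n] are nonnegative, so their partial sums stay below their full sum. *)
Lemma Series_tail_bound (a b : nat -> R) (K : nat) :
  ex_series b -> (forall n, Rabs (a n) <= b n) ->
  Series a - sum_f_R0 a K <= Series b - sum_f_R0 b K.
Proof.
  intros Hb Hab.
  assert (Ha : ex_series a) by (apply (ex_series_le (V := R_CompleteNormedModule)) with b; auto).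
  assert (H := sum_le_Series (fun n => b n - a n) K).
  rewrite Series_minus, minus_sum in H by assumption.
  assert (ex_series (fun n => b n - a n)) by now apply (ex_series_minus (V := R_NormedModule)).
  assert (sum_f_R0 b K - sum_f_R0 a K <= Series b - Series a).
  { apply H; [assumption|]. intros n. specialize (Hab n). apply Rabs_le_between in Hab. lra. }
  lra.
Qed.

Lemma left_limit_ge (f : R -> R) (a b c : R) : a < b -> continuity_pt f b ->
  (forall x, a < x < b -> c <= f x) -> c <= f b.
Proof.
  intros Hab Hf H. destruct (Rle_lt_dec c (f b)) as [|Hlt]; [assumption|exfalso].
  destruct (Hf (c - f b) ltac:(lra)) as (d & Hd & Hd').
  set (x := b - Rmin (d / 2) ((b - a) / 2)).
  assert (Hm : 0 < Rmin (d / 2) ((b - a) / 2)) by (apply Rmin_pos; lra).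
  assert (H1 := Rmin_l (d / 2) ((b - a) / 2)). assert (H2 := Rmin_r (d / 2) ((b - a) / 2)).
  assert (Hx : a < x < b) by (unfold x; lra).
  specialize (H x Hx).
  assert (Hdx : dist R_met (f x) (f b) < c - f b).
  { apply Hd'. split.
    - split; [exact I|]. lra.
    - simpl. unfold Rdist. rewrite Rabs_left; unfold x in *; lra. }
  simpl in Hdx. unfold Rdist in Hdx. apply Rabs_lt_between in Hdx. lra.
Qed.

(* Truncating the series costs an arbitrarily small [e] in the lower bound. *)
Lemma truncated_pairing_nonneg (M : R) (y : nat -> R) (Hy0 : y 0%nat = 0)
  (Hy : Rbar_le 1 (CV_radius y))
  (Hpos : forall r t, 0 <= r < 1 ->
     - M <= Series (fun m => y m * r ^ m * cos (INR m * t)))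
  (r e : R) : 0 <= r < 1 -> 0 < e ->
  exists K0, forall K, (K0 <= K)%nat -> forall p : nat -> R,
    (forall t, 0 <= sum_f_R0 (fun j => p j * cos (INR j * t)) K) ->
    0 <= 2 * (M + e) * p 0%nat + sum_f_R0 (fun m => y m * r ^ m * p m) K.
Proof.
  intros Hr He.
  assert (Hs : ex_series (fun n => Rabs (y n * r ^ n))).
  { apply CV_disk_inside. apply Rbar_lt_le_trans with (2 := Hy). simpl.
    rewrite Rabs_pos_eq; lra. }
  assert (Hl := Series_correct _ Hs).
  apply is_series_Reals in Hl. destruct (Hl e He) as [K0 HK0].
  exists K0. intros K HK p Hp.
  (* Adding M + e to the constant term makes the truncated cosine series nonnegative: the full
     series is at least - M, and the tail beyond [K0] is below e uniformly in t. *)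
  set (x := fun m => (if Nat.eqb m 0 then M + e else 0) + y m * r ^ m).
  assert (H := cos_poly_pairing_nonneg x p K).
  assert (E : forall q : nat -> R, sum_f_R0 (fun m => x m * q m) K =
             (M + e) * q 0%nat + sum_f_R0 (fun m => y m * r ^ m * q m) K).
  { intros q. rewrite <- (sum_indicator (fun m => (M + e) * q m) 0 K) by lia.
    rewrite <- plus_sum. apply sum_eq. intros i _. unfold x.
    destruct (Nat.eqb i 0); ring. }
  (* The constant mode enters once outside the sum and once inside it, whence the factor 2 in
     [2 * (M + e) * p 0]. *)
  rewrite (E p) in H. change (x 0%nat) with (M + e + y 0%nat * 1) in H. rewrite Hy0 in H.
  enough (forall t, 0 <= sum_f_R0 (fun m => x m * cos (INR m * t)) K) as Hx
    by (specialize (H Hx Hp); lra).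
  intros t. rewrite (E (fun m => cos (INR m * t))). simpl. rewrite Rmult_0_l, cos_0.
  specialize (HK0 K HK). unfold Rdist in HK0. apply Rabs_lt_between in HK0.
  assert (HT := Series_tail_bound (fun m => y m * r ^ m * cos (INR m * t)) _ K Hs).
  cbv beta in HT. specialize (Hpos r t Hr).
  assert (Hb : forall n, Rabs (y n * r ^ n * cos (INR n * t)) <= Rabs (y n * r ^ n)).
  { intros n. rewrite (Rabs_mult _ (cos _)).
    assert (Rabs (cos (INR n * t)) <= 1) by (apply Rabs_le, COS_bound).
    assert (0 <= Rabs (y n * r ^ n)) by apply Rabs_pos. nra. }
  specialize (HT Hb). lra.
Qed.

(** Pairing with the nonnegative polynomial 1 + s cos (m t), |s| <= 1, gives 0 <= 2 (M + e) + s y_m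
    r^m. Then e tends to 0, r tends to 1, and s = 1 and s = -1 give the two sides of the bound. *)
Lemma caratheodory_coeff (M : R) (y : nat -> R) (HM : 0 < M) (Hy0 : y 0%nat = 0)
  (Hy : Rbar_le 1 (CV_radius y))
  (Hpos : forall r t, 0 <= r < 1 ->
     - M <= Series (fun m => y m * r ^ m * cos (INR m * t)))
  (m : nat) : Rabs (y m) <= 2 * M.
Proof.
  destruct (Nat.eq_dec m 0) as [->|Hm]; [rewrite Hy0, Rabs_R0; lra|].
  assert (H : forall s r e, Rabs s <= 1 -> 0 <= r < 1 -> 0 < e ->
                0 <= 2 * (M + e) + y m * r ^ m * s).
  { intros s r e Hs Hr He.
    destruct (truncated_pairing_nonneg M y Hy0 Hy Hpos r e Hr He) as [K0 HK].
    set (K := max K0 m).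
    set (p := fun j => (if Nat.eqb j 0 then 1 else 0) + (if Nat.eqb j m then s else 0)).
    assert (E : forall q : nat -> R, sum_f_R0 (fun j => q j * p j) K = q 0%nat + q m * s).
    { intros q. rewrite <- (sum_indicator (fun j => q j) 0 K) by lia.
      rewrite <- (sum_indicator (fun j => q j * s) m K) by (unfold K; lia).
      rewrite <- plus_sum. apply sum_eq. intros i _. unfold p.
      destruct (Nat.eqb i 0), (Nat.eqb i m); ring. }
    assert (Ep : p 0%nat = 1).
    { unfold p. replace (Nat.eqb 0 m) with false by (symmetry; apply Nat.eqb_neq; lia).
      simpl. ring. }
    assert (Hc : forall t, 0 <= sum_f_R0 (fun j => p j * cos (INR j * t)) K).
    { intros t. rewrite (sum_eq _ (fun j => cos (INR j * t) * p j)) by (intros; ring).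
      rewrite (E (fun j => cos (INR j * t))). change (INR 0) with 0.
      rewrite Rmult_0_l, cos_0.
      assert (Hb := COS_bound (INR m * t)). apply Rabs_le_between in Hs. nra. }
    specialize (HK K ltac:(unfold K; lia) p Hc).
    rewrite (E (fun j => y j * r ^ j)), Ep, Hy0 in HK. lra. }
  assert (H2 : forall s r, Rabs s <= 1 -> 0 <= r < 1 -> 0 <= 2 * M + y m * r ^ m * s).
  { intros s r Hs Hr. apply le_epsilon. intros e He.
    specialize (H s r (e / 2) Hs Hr ltac:(lra)). lra. }
  assert (H3 : forall s, Rabs s <= 1 -> 0 <= 2 * M + y m * 1 ^ m * s).
  { intros s Hs. refine (left_limit_ge (fun r => 2 * M + y m * r ^ m * s) 0 1 0 _ _ _); [lra| |].
    - apply derivable_continuous_pt, ex_derive_Reals_0.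
      auto_derive. exact I.
    - intros r Hr. apply H2; [assumption|lra]. }
  rewrite pow1 in H3.
  assert (H4 := H3 1 ltac:(rewrite Rabs_R1; lra)).
  assert (H5 := H3 (-1) ltac:(rewrite Rabs_left; lra)).
  apply Rabs_le. lra.
Qed.

(** Pairing with a truncated Poisson kernel minus its lower bound [c K], and letting K grow,
    evaluates the power series at r x. The subtraction shrinks the constant coefficient of the
    kernel from 1 to 1 - [c K], which produces the factor t / (1 + t). *)
Lemma harnack_lower (M : R) (y : nat -> R) (HM : 0 < M) (Hy0 : y 0%nat = 0)
  (Hy : Rbar_le 1 (CV_radius y))
  (Hpos : forall r t, 0 <= r < 1 ->
     - M <= Series (fun m => y m * r ^ m * cos (INR m * t)))
  (t : R) : 0 <= t < 1 -> - (2 * M * t / (1 + t)) <= PSeries y t.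
Proof.
  intros Ht.
  assert (H : forall x r, 0 <= x < 1 -> 0 <= r < 1 ->
     forall e, 0 < e -> 0 <= 2 * (M + e) * (1 - (1 - x) / (1 + x)) + 2 * PSeries y (r * x)).
  { intros x r Hx Hr e He.
    destruct (truncated_pairing_nonneg M y Hy0 Hy Hpos r e Hr He) as [K0 HK].
    set (c := fun K => (1 - x) / (1 + x) - 4 * x ^ K / (1 - x) ^ 2).
    assert (HK' : forall K, (K0 <= K)%nat ->
       0 <= 2 * (M + e) * (1 - c K) + 2 * sum_n (fun m => y m * (r * x) ^ m) K).
    { intros K HKK.
      (* At j = 0 one unit comes from the normalization of the kernel and [c K] from the subtracted
         lower bound. *)
      set (p := fun j => 2 * x ^ j - (if Nat.eqb j 0 then 1 + c K else 0)).
      assert (E : forall q : nat -> R, sum_f_R0 (fun j => q j * p j) K =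
        sum_f_R0 (fun j => 2 * x ^ j * q j) K - (1 + c K) * q 0%nat).
      { intros q. rewrite <- (sum_indicator (fun j => (1 + c K) * q j) 0 K) by lia.
        rewrite <- minus_sum. apply sum_eq. intros i _. unfold p.
        destruct (Nat.eqb i 0); ring. }
      assert (Ep : p 0%nat = 1 - c K) by (unfold p; simpl; ring).
      assert (Hc : forall t, 0 <= sum_f_R0 (fun j => p j * cos (INR j * t)) K).
      { intros u. rewrite (sum_eq _ (fun j => cos (INR j * u) * p j)) by (intros; ring).
        rewrite (E (fun j => cos (INR j * u))). change (INR 0) with 0.
        rewrite Rmult_0_l, cos_0.
        assert (HP := poisson_kernel_lower x u K Hx). fold (c K) in HP. lra. }
      specialize (HK K HKK p Hc).
      rewrite (E (fun j => y j * r ^ j)), Ep, Hy0 in HK.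
      rewrite sum_n_Reals, scal_sum.
      rewrite (sum_eq _ (fun j => 2 * x ^ j * (y j * r ^ j)))
        by (intros; rewrite Rpow_mult_distr; ring).
      lra. }
    assert (Hxl : is_lim_seq (fun K => x ^ K) 0)
      by (apply is_lim_seq_geom; rewrite Rabs_pos_eq; lra).
    assert (Hcl : is_lim_seq c ((1 - x) / (1 + x))).
    { unfold c. replace ((1 - x) / (1 + x)) with ((1 - x) / (1 + x) - 4 * 0 * / (1 - x) ^ 2) at 1 by ring.
      apply is_lim_seq_minus'; [apply is_lim_seq_const|].
      apply is_lim_seq_mult'; [|apply is_lim_seq_const].
      apply is_lim_seq_mult'; [apply is_lim_seq_const|assumption]. }
    assert (Hs : is_lim_seq (sum_n (fun m => y m * (r * x) ^ m)) (PSeries y (r * x))).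
    { apply (Series_correct (fun m => y m * (r * x) ^ m)).
      apply (proj1 (ex_pseries_R _ _)), CV_radius_inside.
      apply Rbar_lt_le_trans with (2 := Hy). simpl. rewrite Rabs_pos_eq; nra. }
    apply (is_lim_seq_le_loc (fun _ => 0)
      (fun K => 2 * (M + e) * (1 - c K) + 2 * sum_n (fun m => y m * (r * x) ^ m) K) 0
      (2 * (M + e) * (1 - (1 - x) / (1 + x)) + 2 * PSeries y (r * x))).
    - exists K0. exact HK'.
    - apply is_lim_seq_const.
    - apply is_lim_seq_plus'; (apply is_lim_seq_mult'; [apply is_lim_seq_const|]).
      + apply is_lim_seq_minus'; [apply is_lim_seq_const|assumption].
      + assumption. }
  assert (H2 : forall x r, 0 <= x < 1 -> 0 <= r < 1 ->
     0 <= 2 * M * (2 * x) + 2 * PSeries y (r * x) * (1 + x)).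
  { intros x r Hx Hr. apply le_epsilon. intros e He.
    (* After clearing the denominator the excess is 2 (e / 4) (2 x) = e x, which is below e. *)
    specialize (H x r Hx Hr (e / 4) ltac:(lra)).
    replace (1 - (1 - x) / (1 + x)) with (2 * x / (1 + x)) in H by (field; lra).
    apply Rmult_le_compat_r with (r := 1 + x) in H; [|lra].
    replace ((2 * (M + e / 4) * (2 * x / (1 + x)) + 2 * PSeries y (r * x)) * (1 + x)) with
      (2 * (M + e / 4) * (2 * x) + 2 * PSeries y (r * x) * (1 + x)) in H by (field; lra).
    nra. }
  assert (H3 : 0 <= 4 * M * t + 2 * PSeries y t * (1 + t)).
  { refine (left_limit_ge (fun r => 4 * M * t + 2 * PSeries y t * (r + t)) t 1 0 _ _ _); [lra| |].
    - apply derivable_continuous_pt, ex_derive_Reals_0.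
      auto_derive. exact I.
    - intros r Hr.
      assert (0 <= t / r) by (apply Rdiv_le_0_compat; lra).
      assert (t / r < 1) by (apply Rmult_lt_reg_r with r; [lra|]; unfold Rdiv;
        rewrite Rmult_assoc, Rinv_l; lra).
      specialize (H2 (t / r) r ltac:(lra) ltac:(lra)).
      replace (r * (t / r)) with t in H2 by (field; lra).
      apply Rmult_le_compat_l with (r := r) in H2; [|lra].
      rewrite Rmult_0_r in H2.
      replace (r * (2 * M * (2 * (t / r)) + 2 * PSeries y t * (1 + t / r)))
        with (4 * M * t + 2 * PSeries y t * (r + t)) in H2 by (field; lra). exact H2. }
  apply Rmult_le_reg_r with (1 + t); [lra|].
  replace (- (2 * M * t / (1 + t)) * (1 + t)) with (- (2 * M * t)) by (field; lra).
  lra.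
Qed.

(** * Complex derivatives and series *)

Lemma is_derive_C_iff (f : C -> C) (z l : C) :
  is_derive (K := C_AbsRing) (V := C_NormedModule) f z l <->
  (forall e : R, 0 < e -> exists d, 0 < d /\ forall w : C, Cmod (w - z) < d ->
     Cmod (f w - f z - (w - z) * l) <= e * Cmod (w - z)).
Proof.
  split.
  - intros [_ H] e He.
    specialize (H z (fun P HP => HP) (mkposreal e He)).
    destruct H as [d Hd]. exists d. split; [apply cond_pos|].
    intros w Hw. exact (Hd w Hw).
  - intros H. split.
    + exact (is_linear_scal_l (K := C_AbsRing) (V := C_NormedModule) l).
    + intros x Hx e.
      rewrite <- (is_filter_lim_locally_unique (K := C_AbsRing) (V := AbsRing_NormedModule C_AbsRing) z x Hx).
      destruct (H e (cond_pos e)) as (d & Hd & Hd').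
      exists (mkposreal d Hd). intros w Hw. exact (Hd' w Hw).
Qed.

Lemma sum_n_C (c : nat -> C) (n : nat) :
  sum_n (G := C_NormedModule) c n = (sum_n (fun k => Re (c k)) n, sum_n (fun k => Im (c k)) n).
Proof.
  induction n as [|n IH].
  - rewrite !sum_O. now destruct (c 0%nat).
  - rewrite !sum_Sn, IH. reflexivity.
Qed.

(** Balls of [C] are products of real balls, so convergence is componentwise; this opens the real
    theory of series to complex ones. *)
Lemma is_series_C_iff (c : nat -> C) (l : C) :
  is_series (K := C_AbsRing) (V := C_NormedModule) c l <->
  is_series (fun n => Re (c n)) (Re l) /\ is_series (fun n => Im (c n)) (Im l).
Proof.
  unfold is_series. split.
  - intros H. split; apply filterlim_locally; intros e;
      generalize (proj1 (filterlim_locally _ _) H e); apply filter_imp;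
      intros n Hn; rewrite sum_n_C in Hn; apply Hn.
  - intros [H1 H2]. apply filterlim_locally. intros e.
    generalize (filter_and _ _ (proj1 (filterlim_locally _ _) H1 e)
                               (proj1 (filterlim_locally _ _) H2 e)). apply filter_imp.
    intros n Hn. rewrite sum_n_C. exact Hn.
Qed.

Lemma is_series_Re_scal (k : C) (c : nat -> C) (l : C) :
  is_series (K := C_AbsRing) (V := C_NormedModule) c l ->
  is_series (fun n => Re (k * c n)) (Re (k * l)).
Proof.
  intros H. apply is_series_C_iff in H. destruct H as [H1 H2].
  exact (is_series_minus (V := R_NormedModule) _ _ _ _
           (is_series_scal (V := R_NormedModule) (Re k) _ _ H1)
           (is_series_scal (V := R_NormedModule) (Im k) _ _ H2)).
Qed.

(** Serves to express a modulus as the real part of a rotated number. For z nonzero, k is the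
    conjugate of z over |z|. *)
Lemma exists_unit_rotation (z : C) : exists k : C, Cmod k = 1 /\ (k * z)%C = RtoC (Cmod z).
Proof.
  destruct (Ceq_dec z 0) as [->|Hz].
  - exists 1. split; [apply Cmod_1|]. now rewrite Cmod_0, Cmult_0_r.
  - assert (Hm := proj1 (Cmod_gt_0 z) Hz).
    assert (Hm' : RtoC (Cmod z) <> 0) by (intros E; apply RtoC_inj in E; lra).
    exists (Cconj z / Cmod z)%C. split.
    + rewrite Cmod_div by exact Hm'. rewrite Cmod_conj, Cmod_R, Rabs_pos_eq by lra. field; lra.
    + transitivity (Cmod z ^ 2 / Cmod z)%C.
      * rewrite <- RtoC_pow, Cmod2_conj. field; exact Hm'.
      * field; exact Hm'.
Qed.

(** Rotating the sum onto the nonnegative axis and taking real parts reduces the estimate to a real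
    series dominated by b. *)
Lemma Cmod_series_le (c : nat -> C) (l : C) (b : nat -> R) :
  is_series (K := C_AbsRing) (V := C_NormedModule) c l ->
  ex_series b -> (forall n, Cmod (c n) <= b n) -> Cmod l <= Series b.
Proof.
  intros Hc Hb Hcb.
  destruct (exists_unit_rotation l) as (k & Hk & Hkl).
  assert (H := is_series_Re_scal k c l Hc). rewrite Hkl in H. simpl in H.
  rewrite <- (is_series_unique _ _ H).
  assert (Hle : forall n, Rabs (Re (k * c n)) <= b n).
  { intros n. eapply Rle_trans; [apply re_le_Cmod|]. rewrite Cmod_mult, Hk, Rmult_1_l. apply Hcb. }
  eapply Rle_trans; [apply Rle_abs|]. eapply Rle_trans; [apply Series_Rabs|].
  - apply (ex_series_le (V := R_CompleteNormedModule)) with b; [|exact Hb].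
    intros n. unfold norm; simpl. unfold abs; simpl. rewrite Rabs_Rabsolu; apply Hle.
  - apply Series_le; [|exact Hb]. intros n. split; [apply Rabs_pos|apply Hle].
Qed.

Lemma series_terms_bounded (a : nat -> R) :
  ex_series a -> exists B, forall n, Rabs (a n) <= B.
Proof.
  intros H.
  destruct (filterlim_bounded (V := R_NormedModule) a
              (ex_intro _ 0 (ex_series_lim_0 a H))) as [B HB].
  exists B. exact HB.
Qed.

(** A radius R < 1 would be contradicted by boundedness at the midpoint (R + 1) / 2. *)
Lemma CV_radius_ge_1_of_bounded (a : nat -> R) :
  (forall r, 0 <= r < 1 -> exists B, forall n, Rabs (a n * r ^ n) <= B) ->
  Rbar_le 1 (CV_radius a).
Proof.
  intros H. destruct (CV_radius_bounded a) as [Hub _].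
  destruct (CV_radius a) as [R| |] eqn:E; simpl in *.
  - destruct (Rle_lt_dec 1 R) as [|HR]; [assumption|exfalso].
    assert (H0 := CV_radius_ge_0 a). rewrite E in H0. simpl in H0.
    specialize (Hub ((R + 1) / 2) (H ((R + 1) / 2) ltac:(lra))). simpl in Hub. lra.
  - exact I.
  - assert (H0 := CV_radius_ge_0 a). rewrite E in H0. exact H0.
Qed.

Lemma CV_radius_ge_1_of_le (a b : nat -> R) :
  (forall n, Rabs (a n) <= Rabs (b n)) -> Rbar_le 1 (CV_radius b) -> Rbar_le 1 (CV_radius a).
Proof.
  intros Hab Hb. apply CV_radius_ge_1_of_bounded. intros r Hr.
  assert (Hs : ex_series (fun n => Rabs (b n * r ^ n))).
  { apply CV_disk_inside. apply Rbar_lt_le_trans with (2 := Hb). simpl. rewrite Rabs_pos_eq; lra. }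
  destruct (series_terms_bounded _ Hs) as [B HB].
  exists B. intros n. eapply Rle_trans; [|apply (HB n)].
  rewrite Rabs_Rabsolu, !Rabs_mult. apply Rmult_le_compat_r; [apply Rabs_pos|apply Hab].
Qed.

(** At a real point r < 1 the real and imaginary parts of the terms are bounded, hence so is |a_n|
    r^n. *)
Lemma taylor_coeffs_radius (h : C -> C) (a : nat -> C) :
  taylor_coeffs h a -> Rbar_le 1 (CV_radius (fun n => Cmod (a n))).
Proof.
  intros H. apply CV_radius_ge_1_of_bounded. intros r Hr.
  assert (Hm : Cmod r < 1) by (rewrite Cmod_R, Rabs_pos_eq; lra).
  specialize (H r Hm). apply is_series_C_iff in H. destruct H as [H1 H2].
  destruct (series_terms_bounded _ (ex_intro _ _ H1)) as [B1 HB1].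
  destruct (series_terms_bounded _ (ex_intro _ _ H2)) as [B2 HB2].
  exists (B1 + B2). intros n.
  specialize (HB1 n). specialize (HB2 n).
  replace (Rabs (Cmod (a n) * r ^ n)) with (Cmod (a n * Cpow r n)).
  - set (w := (a n * Cpow r n)%C) in *.
    replace w with (RtoC (Re w) + Ci * RtoC (Im w))%C
      by (destruct w; unfold Ci, RtoC, Cplus, Cmult; simpl; f_equal; ring).
    eapply Rle_trans; [apply Cmod_triangle|].
    rewrite Cmod_mult, Cmod_Ci, !Cmod_R. lra.
  - rewrite Cmod_mult, Cmod_pow, Cmod_R, Rabs_mult, (Rabs_pos_eq (Cmod _)) by apply Cmod_ge_0.
    rewrite (Rabs_pos_eq r) by lra. rewrite Rabs_pos_eq by (apply pow_le; lra). reflexivity.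
Qed.

(** Chain rule along a ray: the complex first-order remainder at t u, rotated by k, dominates the
    real one. *)
Lemma is_derive_Re_ray (F : C -> C) (k u l : C) (t : R) :
  is_derive (K := C_AbsRing) (V := C_NormedModule) F (t * u)%C l ->
  is_derive (fun s : R => Re (k * F (s * u)%C)) t (Re (k * (u * l))).
Proof.
  intros H. rewrite is_derive_C_iff in H.
  apply is_derive_Reals. intros e He.
  (* The + 1 keeps B positive when k or u vanishes, and the factor 2 in [e / (2 * B)] leaves room
     for the strict inequality. *)
  set (B := (Cmod k * Cmod u + 1)).
  assert (Hk := Cmod_ge_0 k). assert (Hu := Cmod_ge_0 u).
  assert (HB : 0 < B) by (unfold B; nra).
  destruct (H (e / (2 * B)) ltac:(apply Rdiv_lt_0_compat; lra)) as (d & Hd & Hd').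
  assert (Hd2 : 0 < d / (Cmod u + 1)) by (apply Rdiv_lt_0_compat; lra).
  exists (mkposreal _ Hd2). intros s Hs Hsd. simpl in Hsd.
  assert (Hw : Cmod ((t + s)%R * u - t * u) = Rabs s * Cmod u).
  { replace ((t + s)%R * u - t * u)%C with (s * u)%C by (rewrite RtoC_plus; ring).
    now rewrite Cmod_mult, Cmod_R. }
  assert (Has : 0 < Rabs s) by now apply Rabs_pos_lt.
  assert (Hw' : Cmod ((t + s)%R * u - t * u) < d).
  { rewrite Hw. apply Rle_lt_trans with (Rabs s * (Cmod u + 1)); [nra|].
    apply Rmult_lt_compat_r with (r := Cmod u + 1) in Hsd; [|lra].
    unfold Rdiv in Hsd. rewrite Rmult_assoc, Rinv_l in Hsd; lra. }
  specialize (Hd' _ Hw'). rewrite Hw in Hd'.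
  set (w := (F ((t + s)%R * u) - F (t * u) - ((t + s)%R * u - t * u) * l)%C) in *.
  replace ((Re (k * F ((t + s)%R * u)%C) - Re (k * F (t * u)%C)) / s - Re (k * (u * l)))
    with (Re (k * w) / s).
  2:{ unfold w. replace (k * (F ((t + s)%R * u) - F (t * u) - ((t + s)%R * u - t * u) * l))%C
        with (k * F ((t + s)%R * u) - k * F (t * u) - s * (k * (u * l)))%C
        by (rewrite RtoC_plus; ring).
      generalize (k * F ((t + s)%R * u))%C, (k * F (t * u))%C, (k * (u * l))%C.
      intros [a1 a2] [b1 b2] [c1 c2]. simpl. field. exact Hs. }
  rewrite Rabs_div by exact Hs.
  apply Rmult_lt_reg_r with (Rabs s); [exact Has|].
  unfold Rdiv at 1. rewrite Rmult_assoc, Rinv_l by lra. rewrite Rmult_1_r.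
  eapply Rle_lt_trans; [apply re_le_Cmod|]. rewrite Cmod_mult.
  eapply Rle_lt_trans; [apply Rmult_le_compat_l; [exact Hk|exact Hd']|].
  replace (Cmod k * (e / (2 * B) * (Rabs s * Cmod u)))
    with ((e * Rabs s / (2 * B)) * (Cmod k * Cmod u)) by (field; lra).
  apply Rle_lt_trans with (e * Rabs s / (2 * B) * B).
  - apply Rmult_le_compat_l; [|unfold B; lra].
    apply Rdiv_le_0_compat; [|lra]. apply Rmult_le_pos; lra.
  - replace (e * Rabs s / (2 * B) * B) with (e * Rabs s / 2) by (field; lra). nra.
Qed.

(** * Analytic functions with Re (z F'') >= - M *)

Definition cis (t : R) : C := (cos t, sin t).

Lemma Cmod_cis (t : R) : Cmod (cis t) = 1.
Proof.
  unfold Cmod, cis; simpl. rewrite !Rmult_1_r, Rplus_comm.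
  change (cos t * cos t) with (Rsqr (cos t)). change (sin t * sin t) with (Rsqr (sin t)).
  now rewrite sin2_cos2, sqrt_1.
Qed.

Lemma cis_pow (t : R) (n : nat) : Cpow (cis t) n = cis (INR n * t).
Proof.
  induction n as [|n IH].
  - simpl. unfold cis. now rewrite Rmult_0_l, cos_0, sin_0.
  - rewrite Cpow_S, IH, S_INR. unfold cis, Cmult; simpl.
    replace ((INR n + 1) * t) with (t + INR n * t) by ring.
    rewrite cos_plus, sin_plus. f_equal; ring.
Qed.

Lemma exists_cis (z : C) : Cmod z = 1 -> exists t, z = cis t.
Proof.
  intros Hz. destruct z as [x y].
  assert (H : x ^ 2 + y ^ 2 = 1).
  { assert (E := Cmod2_alt (x, y)). rewrite Hz in E. simpl in *. lra. }
  assert (Hx : -1 <= x <= 1) by nra.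
  assert (Hy : sqrt (1 - x²) = Rabs y).
  { rewrite <- sqrt_Rsqr_abs. f_equal. unfold Rsqr. lra. }
  destruct (Rle_lt_dec 0 y) as [H0|H0].
  - exists (acos x). unfold cis. rewrite cos_acos, sin_acos by assumption.
    rewrite Hy, Rabs_pos_eq by assumption. reflexivity.
  - exists (- acos x). unfold cis. rewrite cos_neg, sin_neg, cos_acos, sin_acos by assumption.
    rewrite Hy, Rabs_left by assumption. f_equal. ring.
Qed.

Lemma exists_unit_root (z : C) (n : nat) :
  Cmod z = 1 -> exists u, Cmod u = 1 /\ Cpow u (S n) = z.
Proof.
  intros Hz. destruct (exists_cis z Hz) as [t ->].
  exists (cis (t / INR (S n))). split; [apply Cmod_cis|].
  rewrite cis_pow. f_equal. field. apply not_0_INR. lia.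
Qed.

Lemma Cconj_mul_unit (u : C) : Cmod u = 1 -> (Cconj u * u)%C = 1.
Proof.
  intros Hu. rewrite Cmult_comm, <- Cmod2_conj, Hu. f_equal. ring.
Qed.

(** The analytic counterpart of the harmonic class: estimates are proved here for one function F,
    then applied to h + e g with e chosen to suit each estimate. *)
Definition half_plane_class (M : R) (F : C -> C) : Prop :=
  exists F' F'' : C -> C,
    (forall z : C, Cmod z < 1 ->
       is_derive (K := C_AbsRing) (V := C_NormedModule) F z (F' z) /\
       is_derive (K := C_AbsRing) (V := C_NormedModule) F' z (F'' z)) /\
    F (RtoC 0) = RtoC 0 /\ F' (RtoC 0) = RtoC 1 /\
    (forall z : C, Cmod z < 1 -> - M <= Re (z * F'' z)).

Lemma is_derive_C_plus_scal (f g : C -> C) (e z l m : C) :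
  is_derive (K := C_AbsRing) (V := C_NormedModule) f z l ->
  is_derive (K := C_AbsRing) (V := C_NormedModule) g z m ->
  is_derive (K := C_AbsRing) (V := C_NormedModule)
    (fun w => f w + e * g w)%C z (l + e * m)%C.
Proof.
  intros Hf Hg. apply is_derive_C_iff. intros r Hr.
  rewrite is_derive_C_iff in Hf, Hg.
  assert (He := Cmod_ge_0 e).
  destruct (Hf (r / 2) ltac:(lra)) as (d1 & Hd1 & H1).
  destruct (Hg (r / 2 / (Cmod e + 1)) ltac:(apply Rdiv_lt_0_compat; lra)) as (d2 & Hd2 & H2).
  exists (Rmin d1 d2). split; [now apply Rmin_pos|]. intros w Hw.
  specialize (H1 w (Rlt_le_trans _ _ _ Hw (Rmin_l _ _))).
  specialize (H2 w (Rlt_le_trans _ _ _ Hw (Rmin_r _ _))).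
  replace (f w + e * g w - (f z + e * g z) - (w - z) * (l + e * m))%C
    with ((f w - f z - (w - z) * l) + e * (g w - g z - (w - z) * m))%C by ring.
  eapply Rle_trans; [apply Cmod_triangle|]. rewrite Cmod_mult.
  assert (Cmod e * Cmod (g w - g z - (w - z) * m) <= r / 2 * Cmod (w - z)); [|lra].
  apply Rle_trans with ((Cmod e + 1) * (r / 2 / (Cmod e + 1) * Cmod (w - z))).
  - apply Rmult_le_compat; [assumption|apply Cmod_ge_0|lra|exact H2].
  - right. field. lra.
Qed.

(** For unimodular e, Re (e z g'') >= - |z g''|, exactly what the term [Cmod (z * g'' z)] in the
    class compensates. *)
Lemma half_plane_class_rotate (M : R) (h g : C -> C) (e : C) :
  in_PH0 M h g -> Cmod e = 1 -> half_plane_class M (fun z => h z + e * g z)%C.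
Proof.
  intros (h' & h'' & g' & g'' & Hd & Hh & Hh' & Hg & Hg' & HM) He.
  exists (fun z => h' z + e * g' z)%C, (fun z => h'' z + e * g'' z)%C.
  split; [|split; [|split]].
  - intros z Hz. destruct (Hd z Hz) as (D1 & D2 & D3 & D4).
    split; now apply is_derive_C_plus_scal.
  - rewrite Hh, Hg. ring.
  - rewrite Hh', Hg'. ring.
  - intros z Hz. specialize (HM z Hz).
    replace (z * (h'' z + e * g'' z))%C with (z * h'' z + e * (z * g'' z))%C by ring.
    assert (H := re_le_Cmod (e * (z * g'' z))). rewrite Cmod_mult, He, Rmult_1_l in H.
    apply Rabs_le_between in H.
    change (Re (?a + ?b)%C) with (Re a + Re b). lra.
Qed.

Lemma taylor_coeffs_plus_scal (h g : C -> C) (a b : nat -> C) (e : C) :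
  taylor_coeffs h a -> taylor_coeffs g b ->
  taylor_coeffs (fun z => h z + e * g z)%C (fun n => a n + e * b n)%C.
Proof.
  intros Ha Hb z Hz.
  apply (is_series_ext (V := C_NormedModule))
    with (fun n => plus (a n * Cpow z n)%C (scal e (b n * Cpow z n)%C)).
  - intros n. change (a n * Cpow z n + e * (b n * Cpow z n) = (a n + e * b n) * Cpow z n)%C. ring.
  - apply (is_series_plus (V := C_NormedModule)); [now apply Ha|].
    apply (is_series_scal (V := C_NormedModule)). now apply Hb.
Qed.

(** The Taylor coefficients of the real function t |-> Re (k F(t u)). *)
Definition ray_coeff (c : nat -> C) (k u : C) (n : nat) : R := Re (k * (c n * Cpow u n)).

Lemma CV_radius_ray_coeff (F : C -> C) (c : nat -> C) (k u : C) :
  Cmod k = 1 -> Cmod u = 1 -> taylor_coeffs F c -> Rbar_le 1 (CV_radius (ray_coeff c k u)).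
Proof.
  intros Hk Hu H. apply CV_radius_ge_1_of_le with (2 := taylor_coeffs_radius F c H).
  intros n. unfold ray_coeff. eapply Rle_trans; [apply re_le_Cmod|].
  rewrite !Cmod_mult, Cmod_pow, Hk, Hu, pow1, Rmult_1_l, Rmult_1_r. apply Rle_abs.
Qed.

Lemma PSeries_ray_coeff (F : C -> C) (c : nat -> C) (k u : C) (t : R) :
  Cmod u = 1 -> Rabs t < 1 -> taylor_coeffs F c ->
  PSeries (ray_coeff c k u) t = Re (k * F (t * u)%C).
Proof.
  intros Hu Ht H. apply is_series_unique.
  apply (is_series_ext (V := R_NormedModule)) with (fun n => Re (k * (c n * Cpow (t * u) n))).
  - intros n. unfold ray_coeff. rewrite Cpow_mult_l, <- RtoC_pow.
    replace (k * (c n * (RtoC (t ^ n) * Cpow u n)))%C with (RtoC (t ^ n) * (k * (c n * Cpow u n)))%C by ring.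
    rewrite re_scal_l. apply Rmult_comm.
  - apply is_series_Re_scal. apply H. now rewrite Cmod_mult, Hu, Cmod_R, Rmult_1_r.
Qed.

Lemma is_derive_eq_on_disc (f g : R -> R) (t a b : R) :
  Rabs t < 1 -> (forall s, Rabs s < 1 -> f s = g s) ->
  is_derive f t a -> is_derive g t b -> a = b.
Proof.
  intros Ht Hfg Hf Hg.
  rewrite <- (is_derive_unique _ _ _ Hf), <- (is_derive_unique _ _ _ Hg).
  apply Derive_ext_loc. exists (mkposreal (1 - Rabs t) ltac:(lra)). intros s Hs.
  apply Hfg. change (Rabs (s - t) < 1 - Rabs t) in Hs.
  assert (H := Rabs_triang (s - t) t). rewrite Rplus_comm, Rplus_minus in H. lra.
Qed.

(** Both sides of the identity for F are differentiated in t, the ray contributing a factor u.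
    Keeping p abstract allows a second application, to F' with k u in place of k. *)
Lemma PSeries_ray_coeff_derive (F F' : C -> C) (c : nat -> C) (k u : C) :
  (forall z : C, Cmod z < 1 -> is_derive (K := C_AbsRing) (V := C_NormedModule) F z (F' z)) ->
  forall p : nat -> R, Cmod u = 1 -> Rbar_le 1 (CV_radius p) ->
  (forall t, Rabs t < 1 -> PSeries p t = Re (k * F (t * u)%C)) ->
  forall t, Rabs t < 1 -> PSeries (PS_derive p) t = Re (k * u * F' (t * u)%C).
Proof.
  intros Hd p Hu Hp HF t Ht.
  apply (is_derive_eq_on_disc _ _ t _ _ Ht HF).
  - apply is_derive_PSeries. apply Rbar_lt_le_trans with (2 := Hp). exact Ht.
  - rewrite <- Cmult_assoc. apply is_derive_Re_ray, Hd.
    now rewrite Cmod_mult, Hu, Cmod_R, Rmult_1_r.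
Qed.

Lemma Re_unit_mul_eq0 (z : C) : (forall k, Cmod k = 1 -> Re (k * z) = 0) -> z = RtoC 0.
Proof.
  intros H. destruct (exists_unit_rotation z) as (k & Hk & Hkz).
  specialize (H k Hk). rewrite Hkz in H. simpl in H. now apply Cmod_eq_0.
Qed.

(** The ray series in direction 1 and its derivative are read off at t = 0; letting k run over the
    unit circle recovers complex values from real parts. *)
Lemma half_plane_class_first_coeffs (M : R) (F : C -> C) (c : nat -> C) :
  half_plane_class M F -> taylor_coeffs F c -> c 0%nat = RtoC 0 /\ c 1%nat = RtoC 1.
Proof.
  intros (F' & F'' & Hd & H0 & H1 & _) Hc.
  assert (Hu := Cmod_1).
  assert (HP := fun k t Ht => PSeries_ray_coeff F c k 1 t Hu Ht Hc).
  assert (HR := fun k Hk => CV_radius_ray_coeff F c k 1 Hk Hu Hc).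
  assert (Hz : Rabs 0 < 1) by (rewrite Rabs_R0; lra).
  split.
  - apply Re_unit_mul_eq0. intros k Hk. specialize (HP k 0 Hz).
    rewrite PSeries_0, Cmult_0_l, H0, Cmult_0_r in HP.
    unfold ray_coeff in HP. simpl Cpow in HP. rewrite Cmult_1_r in HP. exact HP.
  - enough (c 1%nat - 1 = 0)%C as E by (replace (c 1%nat) with (c 1%nat - 1 + 1)%C by ring; rewrite E; ring).
    apply Re_unit_mul_eq0. intros k Hk.
    assert (HP' := PSeries_ray_coeff_derive F F' c k 1 (fun z Hz => proj1 (Hd z Hz)) _ Hu (HR k Hk)
                     (HP k) 0 Hz).
    rewrite PSeries_0, Cmult_0_l, H1, !Cmult_1_r in HP'.
    unfold PS_derive, ray_coeff in HP'. simpl INR in HP'. rewrite Rmult_1_l, Cpow_1_l, Cmult_1_r in HP'.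
    replace (k * (c 1%nat - 1))%C with (k * c 1%nat - k)%C by ring.
    change (Re (?a - ?b)%C) with (Re a - Re b). rewrite HP'. ring.
Qed.

(* The Taylor coefficients of [t |-> Re (t u F''(t u))]. *)
Definition ray_coeff2 (c : nat -> C) (u : C) : nat -> R :=
  PS_incr_1 (PS_derive (PS_derive (ray_coeff c (Cconj u) u))).

(** The factor [Cconj u] cancels one power of u, so coefficient n + 2 of F comes with u^(n + 1). *)
Lemma ray_coeff2_S (c : nat -> C) (u : C) (n : nat) : Cmod u = 1 ->
  ray_coeff2 c u (S n) = INR (S n) * (INR (S (S n)) * Re (c (S (S n)) * Cpow u (S n))).
Proof.
  intros Hu.
  change (ray_coeff2 c u (S n)) with
    (INR (S n) * (INR (S (S n)) * Re (Cconj u * (c (S (S n)) * Cpow u (S (S n)))))).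
  do 2 f_equal. rewrite (Cpow_S u (S n)).
  replace (Cconj u * (c (S (S n)) * (u * Cpow u (S n))))%C
    with (Cconj u * u * (c (S (S n)) * Cpow u (S n)))%C by ring.
  rewrite Cconj_mul_unit by exact Hu. now rewrite Cmult_1_l.
Qed.

(** The opposite rotations by n s contribute sine parts that cancel. For n = 0 both sides vanish. *)
Lemma ray_coeff2_cos (c : nat -> C) (u : C) (s : R) (n : nat) : Cmod u = 1 ->
  ray_coeff2 c (u * cis s) n + ray_coeff2 c (u * cis (- s)) n =
  2 * (ray_coeff2 c u n * cos (INR n * s)).
Proof.
  intros Hu. destruct n as [|n].
  - change (0 + 0 = 2 * (0 * cos (INR 0 * s))). ring.
  - rewrite !ray_coeff2_S by (rewrite ?Cmod_mult, ?Cmod_cis, Hu; ring).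
    rewrite !Cpow_mult_l, !cis_pow, !Cmult_assoc.
    generalize (c (S (S n)) * Cpow u (S n))%C. intros [x y].
    rewrite Ropp_mult_distr_r_reverse. unfold cis. rewrite cos_neg, sin_neg. simpl Re. simpl. ring.
Qed.

Lemma PSeries_ray_coeff2 (M : R) (F : C -> C) (c : nat -> C) (u : C) :
  half_plane_class M F -> taylor_coeffs F c -> Cmod u = 1 ->
  Rbar_le 1 (CV_radius (ray_coeff2 c u)) /\
  forall t, 0 <= t < 1 -> - M <= PSeries (ray_coeff2 c u) t.
Proof.
  intros (F' & F'' & Hd & _ & _ & HM) Hc Hu.
  assert (Hu' : Cmod (Cconj u) = 1) by now rewrite Cmod_conj.
  assert (HR := CV_radius_ray_coeff F c (Cconj u) u Hu' Hu Hc).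
  assert (HP0 := fun t Ht => PSeries_ray_coeff F c (Cconj u) u t Hu Ht Hc).
  assert (HP1 := PSeries_ray_coeff_derive F F' c (Cconj u) u (fun z Hz => proj1 (Hd z Hz)) _ Hu HR HP0).
  assert (HR1 := HR). rewrite <- CV_radius_derive in HR1.
  assert (HP2 := PSeries_ray_coeff_derive F' F'' c (Cconj u * u) u (fun z Hz => proj2 (Hd z Hz)) _ Hu HR1 HP1).
  split.
  - unfold ray_coeff2. now rewrite CV_radius_incr_1, CV_radius_derive.
  - intros t Ht. unfold ray_coeff2. rewrite PSeries_incr_1, HP2 by (rewrite Rabs_pos_eq; lra).
    (* Two differentiations leave the factor (conj u) u u = u; with the extra t it becomes the point
       t u that multiplies F''. *)
    rewrite <- re_scal_l, Cconj_mul_unit, Cmult_1_l, Cmult_assoc by exact Hu.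
    apply HM. rewrite Cmod_mult, Hu, Cmod_R, Rabs_pos_eq; lra.
Qed.

(* Averaging the rays in directions [u e^(is)] and [u e^(-is)] leaves a cosine series. *)
Lemma ray_coeff2_cos_series (M : R) (F : C -> C) (c : nat -> C) (u : C) :
  half_plane_class M F -> taylor_coeffs F c -> Cmod u = 1 ->
  forall r s, 0 <= r < 1 ->
    - M <= Series (fun m => ray_coeff2 c u m * r ^ m * cos (INR m * s)).
Proof.
  intros HF Hc Hu r s Hr.
  assert (H : forall v, Cmod v = 1 -> - M <= PSeries (ray_coeff2 c v) r /\
                 ex_series (fun n => ray_coeff2 c v n * r ^ n)).
  { intros v Hv. destruct (PSeries_ray_coeff2 M F c v HF Hc Hv) as [H1 H2].
    split; [now apply H2|]. apply (proj1 (ex_pseries_R _ _)), CV_radius_inside.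
    apply Rbar_lt_le_trans with (2 := H1). simpl. rewrite Rabs_pos_eq; lra. }
  destruct (H (u * cis s)%C) as [A1 A2]; [rewrite Cmod_mult, Cmod_cis, Hu; ring|].
  destruct (H (u * cis (- s))%C) as [B1 B2]; [rewrite Cmod_mult, Cmod_cis, Hu; ring|].
  rewrite (Series_ext _ (fun m => / 2 * (ray_coeff2 c (u * cis s) m * r ^ m +
                                         ray_coeff2 c (u * cis (- s)) m * r ^ m))).
  - rewrite Series_scal_l, Series_plus by assumption. unfold PSeries in *. lra.
  - intros n. rewrite <- Rmult_plus_distr_r, ray_coeff2_cos by exact Hu. field.
Qed.

(** The direction u is chosen so that u^(n + 1) rotates c_(n+2) onto the nonnegative axis; the ray
    coefficient then sees the full modulus and Caratheodory's bound applies. *)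
Lemma half_plane_class_coeff_bound (M : R) (F : C -> C) (c : nat -> C) (n : nat) : 0 < M ->
  half_plane_class M F -> taylor_coeffs F c ->
  INR (S n) * INR (S (S n)) * Cmod (c (S (S n))) <= 2 * M.
Proof.
  intros HM HF Hc.
  destruct (exists_unit_rotation (c (S (S n)))) as (k & Hk & Hkc).
  destruct (exists_unit_root k n Hk) as (u & Hu & Huk).
  assert (H := caratheodory_coeff M (ray_coeff2 c u) HM eq_refl
    (proj1 (PSeries_ray_coeff2 M F c u HF Hc Hu)) (ray_coeff2_cos_series M F c u HF Hc Hu) (S n)).
  rewrite ray_coeff2_S, Huk, Cmult_comm, Hkc in H by exact Hu. simpl Re in H.
  apply Rle_trans with (2 := H). rewrite Rmult_assoc. apply Rle_abs.
Qed.

Lemma nondecreasing_of_derive_nonneg (f f' : R -> R) (t : R) : 0 <= t < 1 ->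
  (forall s, 0 <= s < 1 -> is_derive f s (f' s)) -> (forall s, 0 < s < 1 -> 0 <= f' s) ->
  f 0 <= f t.
Proof.
  intros Ht Hd Hp. destruct (Req_dec t 0) as [->|Ht0]; [lra|].
  destruct (MVT_cor2 f f' 0 t) as (s & E & Hs); [lra| |].
  - intros x Hx. apply is_derive_Reals, Hd. lra.
  - specialize (Hp s ltac:(lra)). nra.
Qed.

Lemma half_plane_class_growth (M : R) (F : C -> C) (c : nat -> C) (u : C) (t : R) : 0 < M ->
  half_plane_class M F -> taylor_coeffs F c -> Cmod u = 1 -> 0 <= t < 1 ->
  t - 2 * M * ((1 + t) * ln (1 + t) - t) <= Re (Cconj u * F (t * u)%C).
Proof.
  intros HM HF Hc Hu Ht.
  assert (Hu' : Cmod (Cconj u) = 1) by now rewrite Cmod_conj.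
  set (p := ray_coeff c (Cconj u) u).
  assert (HR : Rbar_le 1 (CV_radius p)) by (eapply CV_radius_ray_coeff; eassumption).
  rewrite <- (PSeries_ray_coeff F c (Cconj u) u t Hu ltac:(rewrite Rabs_pos_eq; lra) Hc).
  fold p.
  assert (Hin : forall s, 0 <= s < 1 -> Rbar_lt (Rabs s) (CV_radius p)).
  { intros s Hs. apply Rbar_lt_le_trans with (2 := HR). simpl. rewrite Rabs_pos_eq; lra. }
  (* Harnack's bound divided by s, hence only for s > 0; the mean value theorem asks for nothing at
     the endpoint. *)
  assert (Hp2 : forall s, 0 < s < 1 ->
            0 <= PSeries (PS_derive (PS_derive p)) s + 2 * M / (1 + s)).
  { intros s Hs.
    assert (H := harnack_lower M (ray_coeff2 c u) HM eq_refl
      (proj1 (PSeries_ray_coeff2 M F c u HF Hc Hu)) (ray_coeff2_cos_series M F c u HF Hc Hu)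
      s ltac:(lra)).
    unfold ray_coeff2 in H. rewrite PSeries_incr_1 in H. fold p in H.
    apply Rmult_le_reg_l with s; [lra|].
    replace (s * (PSeries (PS_derive (PS_derive p)) s + 2 * M / (1 + s)))
      with (s * PSeries (PS_derive (PS_derive p)) s + 2 * M * s / (1 + s)) by (field; lra).
    lra. }
  destruct (half_plane_class_first_coeffs M F c HF Hc) as [Hc0 Hc1].
  assert (Hp0 : p 0%nat = 0).
  { unfold p, ray_coeff. rewrite Hc0, Cmult_0_l, Cmult_0_r. reflexivity. }
  assert (Hp1 : PS_derive p 0%nat = 1).
  { unfold PS_derive, p, ray_coeff. rewrite Hc1, Cmult_1_l, Cpow_1_r, Cconj_mul_unit by exact Hu.
    simpl. ring. }
  assert (H1 : forall s, 0 <= s < 1 -> 0 <= PSeries (PS_derive p) s - 1 + 2 * M * ln (1 + s)).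
  { intros s Hs.
    assert (H := nondecreasing_of_derive_nonneg
      (fun x => PSeries (PS_derive p) x - 1 + 2 * M * ln (1 + x))
      (fun x => PSeries (PS_derive (PS_derive p)) x + 2 * M / (1 + x)) s Hs).
    cbv beta in H. rewrite PSeries_0, Hp1, Rplus_0_r, ln_1 in H.
    replace (1 - 1 + 2 * M * 0) with 0 in H by ring.
    apply H; [|exact Hp2]. intros x Hx.
    apply (is_derive_plus (V := R_NormedModule)).
    - rewrite <- (Rminus_0_r (PSeries (PS_derive (PS_derive p)) x)).
      apply (is_derive_minus (V := R_NormedModule)); [|apply (is_derive_const (V := R_NormedModule))].
      apply is_derive_PSeries. rewrite CV_radius_derive. now apply Hin.
    - auto_derive; [lra|]. field. lra. }
  (* Second integration: (1 + x) ln (1 + x) - x is the antiderivative of ln (1 + x) vanishing at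
     0. *)
  assert (H := nondecreasing_of_derive_nonneg
      (fun x => PSeries p x - x + 2 * M * ((1 + x) * ln (1 + x) - x))
      (fun x => PSeries (PS_derive p) x - 1 + 2 * M * ln (1 + x)) t Ht).
  cbv beta in H. rewrite PSeries_0, Hp0, Rplus_0_r, ln_1 in H.
  assert (H' : 0 - 0 + 2 * M * (1 * 0 - 0) <=
     PSeries p t - t + 2 * M * ((1 + t) * ln (1 + t) - t)); [|lra].
  apply H; [|intros x Hx; apply H1; lra]. intros x Hx.
  apply (is_derive_plus (V := R_NormedModule)).
  - apply (is_derive_minus (V := R_NormedModule)); [|apply (is_derive_id (K := R_AbsRing))].
    apply is_derive_PSeries. now apply Hin.
  - auto_derive; [lra|]. field. lra.
Qed.

(** * The power series of x + (1 - x) ln (1 - x) *)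

Definition log_coeff (n : nat) : R :=
  match n with S (S k) => / (INR (S k) * INR (S (S k))) | _ => 0 end.

Lemma CV_radius_log_coeff : Rbar_le 1 (CV_radius log_coeff).
Proof.
  apply CV_radius_ge_1_of_bounded. intros r Hr. exists 1. intros n.
  assert (0 <= r ^ n <= 1) by (split; [apply pow_le; lra|rewrite <- (pow1 n); apply pow_incr; lra]).
  assert (0 <= log_coeff n <= 1).
  { destruct n as [|[|n]]; unfold log_coeff; try lra.
    assert (1 <= INR (S n)) by (rewrite S_INR; assert (H0 := pos_INR n); lra).
    assert (1 <= INR (S (S n))) by (rewrite S_INR; lra).
    assert (1 <= INR (S n) * INR (S (S n))) by nra.
    split; [left; apply Rinv_0_lt_compat; lra|].
    rewrite <- Rinv_1. apply Rinv_le_contravar; lra. }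
  rewrite Rabs_pos_eq by (apply Rmult_le_pos; lra). nra.
Qed.

Lemma eq_0_of_derive_0 (f : R -> R) (x : R) : Rabs x < 1 ->
  (forall s, Rabs s < 1 -> is_derive f s 0) -> f 0 = 0 -> f x = 0.
Proof.
  intros Hx Hf H0.
  destruct (MVT_gen f 0 x (fun _ => 0)) as (s & _ & E).
  - intros s Hs. apply Hf. apply Rabs_lt_between in Hx. apply Rabs_lt_between.
    destruct (Rle_lt_dec 0 x); [rewrite Rmin_left, Rmax_right in Hs by lra|
      rewrite Rmin_right, Rmax_left in Hs by lra]; lra.
  - intros s Hs. apply continuity_pt_filterlim, (ex_derive_continuous (V := R_NormedModule) f).
    exists 0. apply Hf. apply Rabs_lt_between in Hx. apply Rabs_lt_between.
    destruct (Rle_lt_dec 0 x); [rewrite Rmin_left, Rmax_right in Hs by lra|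
      rewrite Rmin_right, Rmax_left in Hs by lra]; lra.
  - lra.
Qed.

(** The second formal derivative is the geometric series. Integrating twice means checking that a
    difference has zero derivative and vanishes at 0. *)
Lemma PSeries_log_coeff (x : R) : Rabs x < 1 ->
  PSeries log_coeff x = x + (1 - x) * ln (1 - x).
Proof.
  assert (HR := CV_radius_log_coeff).
  assert (Hin : forall s, Rabs s < 1 -> Rbar_lt (Rabs s) (CV_radius log_coeff))
    by (intros s Hs; apply Rbar_lt_le_trans with (2 := HR); exact Hs).
  assert (H2 : forall s, Rabs s < 1 -> PSeries (PS_derive (PS_derive log_coeff)) s = / (1 - s)).
  { intros s Hs. apply is_series_unique.
    apply (is_series_ext (V := R_NormedModule)) with (fun n => s ^ n); [|now apply is_series_geom].
    intros n. change (@eq R (s ^ n)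
      (INR (S n) * (INR (S (S n)) * / (INR (S n) * INR (S (S n)))) * s ^ n)). field. split; apply not_0_INR; lia. }
  assert (H1 : forall s, Rabs s < 1 -> PSeries (PS_derive log_coeff) s + ln (1 - s) = 0).
  { intros s Hs. apply (eq_0_of_derive_0 (fun s => PSeries (PS_derive log_coeff) s + ln (1 - s)) s Hs).
    - intros w Hw. assert (Hw' := Hw). apply Rabs_lt_between in Hw'.
      replace 0 with (PSeries (PS_derive (PS_derive log_coeff)) w + - / (1 - w))
        by (rewrite H2 by exact Hw; ring).
      apply (is_derive_plus (V := R_NormedModule)).
      + apply is_derive_PSeries. rewrite CV_radius_derive. now apply Hin.
      + auto_derive; [lra|]. field. lra.
    - rewrite PSeries_0, Rminus_0_r, ln_1. unfold PS_derive. simpl. ring. }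
  intros Hx.
  enough (PSeries log_coeff x - (x + (1 - x) * ln (1 - x)) = 0) by lra.
  apply (eq_0_of_derive_0 (fun x => PSeries log_coeff x - (x + (1 - x) * ln (1 - x))) x Hx).
  - intros w Hw. assert (Hw' := Hw). apply Rabs_lt_between in Hw'.
    replace 0 with (PSeries (PS_derive log_coeff) w - - ln (1 - w))
      by (rewrite <- (H1 w Hw); ring).
    apply (is_derive_minus (V := R_NormedModule)).
    + apply is_derive_PSeries. now apply Hin.
    + auto_derive; [lra|]. change (1 + - w) with (1 - w). field. lra.
  - rewrite PSeries_0, Rminus_0_r, ln_1. simpl. ring.
Qed.

(** * The extremal function *)

(** Componentwise, since [Series] is a total function on real sequences; the value is meaningful
    where the series converges. *)
Definition Cpseries (a : nat -> R) (z : C) : C :=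
  (Series (fun n => Re (a n * Cpow z n)), Series (fun n => Im (a n * Cpow z n))).

Lemma im_le_Cmod (z : C) : Rabs (Im z) <= Cmod z.
Proof. eapply Rle_trans; [apply Rmax_r|apply Rmax_Cmod]. Qed.

Lemma taylor_coeffs_Cpseries (a : nat -> R) :
  Rbar_le 1 (CV_radius a) -> taylor_coeffs (Cpseries a) (fun n => RtoC (a n)).
Proof.
  intros Ha z Hz. apply is_series_C_iff.
  assert (Hs : ex_series (fun n => Rabs (a n * Cmod z ^ n))).
  { apply CV_disk_inside. apply Rbar_lt_le_trans with (2 := Ha). simpl.
    now rewrite Rabs_pos_eq by apply Cmod_ge_0. }
  assert (Hm : forall n, Cmod (a n * Cpow z n) = Rabs (a n * Cmod z ^ n)).
  { intros n. rewrite Cmod_mult, Cmod_R, Cmod_pow, Rabs_mult, (Rabs_pos_eq (_ ^ n)); [reflexivity|].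
    apply pow_le, Cmod_ge_0. }
  split; apply Series_correct;
    apply (ex_series_le (V := R_CompleteNormedModule)) with (2 := Hs); intros n;
    change norm with Rabs; rewrite <- Hm; [apply re_le_Cmod|apply im_le_Cmod].
Qed.

Lemma Cpseries_real (a : nat -> R) (x : R) : Cpseries a (RtoC x) = RtoC (PSeries a x).
Proof.
  unfold Cpseries, RtoC at 5. f_equal.
  - apply Series_ext. intros n. rewrite <- RtoC_pow, <- RtoC_mult. reflexivity.
  - rewrite (Series_ext _ (fun _ => 0 * 0)).
    + rewrite Series_scal_l. ring.
    + intros n. rewrite <- RtoC_pow, <- RtoC_mult. simpl. ring.
Qed.

Lemma is_series_C_unique (c : nat -> C) (l m : C) :
  is_series (K := C_AbsRing) (V := C_NormedModule) c l ->
  is_series (K := C_AbsRing) (V := C_NormedModule) c m -> l = m.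
Proof.
  intros Hl Hm. apply is_series_C_iff in Hl, Hm. destruct Hl as [A1 A2], Hm as [B1 B2].
  apply is_series_unique in A1, A2, B1, B2. destruct l, m. simpl in *. congruence.
Qed.

(** The remainder for n + 1 is w times the remainder for n plus (w - z)^2 (n + 1) z^n. The constant
    n (n + 1) is that of a second derivative, so summability will follow from the second formal
    derivative; at n = 0 it annihilates the value of [pred]. *)
Lemma Cpow_remainder_bound (w z : C) (r : R) (n : nat) : Cmod w <= r -> Cmod z <= r ->
  Cmod (Cpow w (S n) - Cpow z (S n) - (w - z) * (INR (S n) * Cpow z n)) <=
  INR n * INR (S n) * r ^ pred n * Cmod (w - z) ^ 2.
Proof.
  intros Hw Hz. assert (H0 := Cmod_ge_0 w). assert (H1 := Cmod_ge_0 z).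
  induction n as [|n IH].
  - replace (Cpow w 1 - Cpow z 1 - (w - z) * (INR 1 * Cpow z 0))%C with (RtoC 0)
      by (simpl; ring).
    rewrite Cmod_0. simpl. lra.
  - replace (Cpow w (S (S n)) - Cpow z (S (S n)) - (w - z) * (INR (S (S n)) * Cpow z (S n)))%C
      with (w * (Cpow w (S n) - Cpow z (S n) - (w - z) * (INR (S n) * Cpow z n)) +
            (w - z) * (w - z) * (INR (S n) * Cpow z n))%C
      by (rewrite (S_INR (S n)), RtoC_plus, !Cpow_S; ring).
    eapply Rle_trans; [apply Cmod_triangle|].
    rewrite !Cmod_mult, Cmod_R, Cmod_pow, (Rabs_pos_eq (INR _)) by apply pos_INR.
    set (D := Cmod (w - z)) in *. assert (HD : 0 <= D) by apply Cmod_ge_0.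
    assert (Hn := pos_INR n).
    assert (A : Cmod w * Cmod (Cpow w (S n) - Cpow z (S n) - (w - z) * (INR (S n) * Cpow z n)) <=
                INR n * INR (S n) * r ^ n * D ^ 2).
    { apply Rle_trans with (r * (INR n * INR (S n) * r ^ pred n * D ^ 2)).
      - apply Rmult_le_compat; [assumption|apply Cmod_ge_0|assumption|exact IH].
      - right. destruct n as [|n]; simpl pred; [simpl; ring|].
        rewrite <- (tech_pow_Rmult r n). ring. }
    assert (B : D * D * (INR (S n) * Cmod z ^ n) <= INR (S n) * r ^ n * D ^ 2).
    { replace (INR (S n) * r ^ n * D ^ 2) with (D * D * (INR (S n) * r ^ n)) by ring.
      apply Rmult_le_compat_l; [nra|]. apply Rmult_le_compat_l; [apply pos_INR|].
      apply pow_incr. lra. }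
    assert (P : 0 <= INR (S n) * r ^ n * D ^ 2).
    { apply Rmult_le_pos; [apply Rmult_le_pos; [apply pos_INR|apply pow_le; lra]|nra]. }
    simpl pred. rewrite (S_INR (S n)).
    assert (E : INR (S n) * (INR (S n) + 1) * r ^ n * D ^ 2 =
            INR n * INR (S n) * r ^ n * D ^ 2 + INR (S n) * r ^ n * D ^ 2 + INR (S n) * r ^ n * D ^ 2)
      by (rewrite !S_INR; ring).
    lra.
Qed.

(** Termwise differentiation: the remainders of the powers are summed on a disc of radius r between
    |z| and 1, giving an error quadratic in |w - z|. *)
Lemma is_derive_Cpseries (a : nat -> R) (z : C) : Rbar_le 1 (CV_radius a) -> Cmod z < 1 ->
  is_derive (K := C_AbsRing) (V := C_NormedModule) (Cpseries a) z (Cpseries (PS_derive a) z).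
Proof.
  intros Ha Hz. apply is_derive_C_iff. intros e He.
  assert (Hz0 := Cmod_ge_0 z). set (r := (1 + Cmod z) / 2).
  assert (Hr : Cmod z < r < 1) by (unfold r; lra).
  set (b := fun n => Rabs (a (S n)) * (INR n * INR (S n) * r ^ pred n)).
  assert (Hb : ex_series b).
  { apply ex_series_incr_1.
    assert (Hs : ex_series (fun n => Rabs (PS_derive (PS_derive a) n * r ^ n))).
    { apply CV_disk_inside. rewrite !CV_radius_derive.
      apply Rbar_lt_le_trans with (2 := Ha). simpl. rewrite Rabs_pos_eq; lra. }
    revert Hs. apply ex_series_ext. intros n. unfold b, PS_derive.
    rewrite !Rabs_mult, !(Rabs_pos_eq (INR _)), (Rabs_pos_eq (r ^ n)) by (apply pos_INR || apply pow_le; lra).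
    change (pred (S n)) with n.
    generalize (INR (S n)) (INR (S (S n))) (r ^ n) (Rabs (a (S (S n)))). intros; simpl; ring. }
  assert (Hb0 : 0 <= Series b).
  { apply Rle_trans with (sum_f_R0 b 0); [simpl; unfold b; simpl; lra|].
    apply sum_le_Series; [exact Hb|]. intros n. unfold b.
    repeat apply Rmult_le_pos; try apply Rabs_pos; try apply pos_INR. apply pow_le. lra. }
  (* The first bound keeps w in the disc of radius r, the second turns the quadratic error into e |w
     - z|; the + 1 avoids a zero denominator. *)
  exists (Rmin (r - Cmod z) (e / (Series b + 1))).
  split; [apply Rmin_pos; [lra|apply Rdiv_lt_0_compat; lra]|]. intros w Hw.
  assert (Hw1 := Rlt_le_trans _ _ _ Hw (Rmin_l _ _)).
  assert (Hw2 := Rlt_le_trans _ _ _ Hw (Rmin_r _ _)).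
  assert (Hwr : Cmod w <= r).
  { assert (H := Cmod_triangle (w - z) z). replace (w - z + z)%C with w in H by ring. lra. }
  assert (Hsh : forall v, Cmod v < 1 ->
     is_series (K := C_AbsRing) (V := C_NormedModule)
       (fun n => a (S n) * Cpow v (S n))%C (Cpseries a v - a 0%nat)%C).
  { intros v Hv. apply (is_series_incr_1 (V := C_NormedModule) (fun n => a n * Cpow v n)%C).
    change (is_series (K := C_AbsRing) (V := C_NormedModule) (fun n => a n * Cpow v n)%C
      (Cpseries a v - a 0%nat + a 0%nat * Cpow v 0)%C).
    replace (Cpseries a v - a 0%nat + a 0%nat * Cpow v 0)%C with (Cpseries a v)
      by (simpl Cpow; ring).
    exact (taylor_coeffs_Cpseries a Ha v Hv). }
  assert (Hser : is_series (K := C_AbsRing) (V := C_NormedModule)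
    (fun n => a (S n) * (Cpow w (S n) - Cpow z (S n) - (w - z) * (INR (S n) * Cpow z n)))%C
    (Cpseries a w - Cpseries a z - (w - z) * Cpseries (PS_derive a) z)%C).
  { assert (H1 := Hsh w ltac:(lra)). assert (H2 := Hsh z Hz).
    assert (HD : Rbar_le 1 (CV_radius (PS_derive a))) by now rewrite CV_radius_derive.
    assert (H3 := is_series_scal (V := C_NormedModule) (w - z)%C _ _
                    (taylor_coeffs_Cpseries _ HD z Hz)).
    assert (H4 := is_series_minus (V := C_NormedModule) _ _ _ _
                   (is_series_minus (V := C_NormedModule) _ _ _ _ H1 H2) H3).
    replace (Cpseries a w - Cpseries a z - (w - z) * Cpseries (PS_derive a) z)%C
      with ((Cpseries a w - a 0%nat) - (Cpseries a z - a 0%nat) - (w - z) * Cpseries (PS_derive a) z)%C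
      by ring.
    revert H4. apply (is_series_ext (V := C_NormedModule)). intros n.
    change (a (S n) * Cpow w (S n) - a (S n) * Cpow z (S n) -
              (w - z) * (RtoC (INR (S n) * a (S n)) * Cpow z n) =
            a (S n) * (Cpow w (S n) - Cpow z (S n) - (w - z) * (INR (S n) * Cpow z n)))%C.
    rewrite RtoC_mult. ring. }
  assert (Hle := Cmod_series_le _ _ (fun n => b n * Cmod (w - z) ^ 2) Hser).
  rewrite Series_scal_r in Hle.
  assert (HD := Cmod_ge_0 (w - z)).
  apply Rle_trans with (Series b * Cmod (w - z) ^ 2).
  - apply Hle.
    + now apply ex_series_scal_r.
    + intros n. rewrite Cmod_mult, Cmod_R. unfold b. rewrite Rmult_assoc.
      apply Rmult_le_compat_l; [apply Rabs_pos|]. apply Cpow_remainder_bound; lra.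
  - replace (Series b * Cmod (w - z) ^ 2) with (Series b * Cmod (w - z) * Cmod (w - z)) by ring.
    apply Rmult_le_compat_r; [exact HD|].
    apply Rle_trans with ((Series b + 1) * (e / (Series b + 1))); [|right; field; lra].
    apply Rmult_le_compat; lra.
Qed.

(** The coefficients of f_M, split so that linearity gives its closed form on the real axis. *)
Definition extremal_coeff (M : R) : nat -> R :=
  PS_plus (fun n => if Nat.eqb n 1 then 1 else 0) (PS_scal (2 * M) log_coeff).

Lemma CV_radius_indicator (k : nat) :
  Rbar_le 1 (CV_radius (fun n => if Nat.eqb n k then 1 else 0)).
Proof.
  apply CV_radius_ge_1_of_bounded. intros r Hr. exists 1. intros n.
  assert (0 <= r ^ n <= 1) by (split; [apply pow_le; lra|rewrite <- (pow1 n); apply pow_incr; lra]).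
  destruct (Nat.eqb n k); rewrite Rabs_pos_eq; lra.
Qed.

Lemma CV_radius_extremal_coeff (M : R) : 0 < M -> Rbar_le 1 (CV_radius (extremal_coeff M)).
Proof.
  intros HM. eapply Rbar_le_trans; [|apply CV_radius_plus].
  rewrite CV_radius_scal by lra.
  apply Rbar_min_case; [apply CV_radius_indicator|apply CV_radius_log_coeff].
Qed.

Lemma PSeries_indicator_1 (x : R) : Rabs x < 1 ->
  PSeries (fun n => if Nat.eqb n 1 then 1 else 0) x = x.
Proof.
  intros Hx.
  rewrite (PSeries_ext _ (PS_incr_1 (fun n => if Nat.eqb n 0 then 1 else 0))) by now intros [|n].
  rewrite PSeries_incr_1, PSeries_decr_1.
  - rewrite (PSeries_ext _ (fun _ => 0)) by reflexivity. rewrite PSeries_const_0. simpl. ring.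
  - apply CV_radius_inside. apply Rbar_lt_le_trans with (2 := CV_radius_indicator 0). exact Hx.
Qed.

Lemma PSeries_extremal_coeff (M x : R) : Rabs x < 1 ->
  PSeries (extremal_coeff M) x = x + 2 * M * (x + (1 - x) * ln (1 - x)).
Proof.
  intros Hx. unfold extremal_coeff. rewrite PSeries_plus.
  - now rewrite PSeries_scal, PSeries_indicator_1, PSeries_log_coeff.
  - apply CV_radius_inside. apply Rbar_lt_le_trans with (2 := CV_radius_indicator 1). exact Hx.
  - apply ex_pseries_scal; [apply Rmult_comm|].
    apply CV_radius_inside. apply Rbar_lt_le_trans with (2 := CV_radius_log_coeff). exact Hx.
Qed.

Lemma extremal_coeff_SS (M : R) (n : nat) :
  extremal_coeff M (S (S n)) = 2 * M / (INR (S n) * INR (S (S n))).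
Proof. change (0 + 2 * M * / (INR (S n) * INR (S (S n))) = 2 * M / (INR (S n) * INR (S (S n)))). apply Rplus_0_l. Qed.

(** Here F'' = 2 M / (1 - z) and z F'' = F'' - 2 M, so the claim is Re (1 / (1 - z)) > 1/2, which
    holds in the unit disc. *)
Lemma extremal_in_PH0 (M : R) : 0 < M ->
  in_PH0 M (Cpseries (extremal_coeff M)) (fun _ => RtoC 0).
Proof.
  intros HM. assert (HR := CV_radius_extremal_coeff M HM).
  set (a := extremal_coeff M) in *.
  exists (Cpseries (PS_derive a)), (Cpseries (PS_derive (PS_derive a))),
    (fun _ => RtoC 0), (fun _ => RtoC 0).
  assert (HR1 : Rbar_le 1 (CV_radius (PS_derive a))) by now rewrite CV_radius_derive.
  assert (HR2 : Rbar_le 1 (CV_radius (PS_derive (PS_derive a)))) by now rewrite CV_radius_derive.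
  split; [|split; [|split; [|split; [reflexivity|split; [reflexivity|]]]]].
  - intros z Hz.
    assert (H0 := is_derive_const (K := C_AbsRing) (V := C_NormedModule) (RtoC 0) z).
    split; [now apply is_derive_Cpseries|]. split; [now apply is_derive_Cpseries|].
    split; exact H0.
  - rewrite Cpseries_real, PSeries_0. f_equal. unfold a, extremal_coeff, PS_plus, PS_scal.
    simpl. change plus with Rplus. change scal with Rmult. ring.
  - rewrite Cpseries_real, PSeries_0. f_equal. unfold a, extremal_coeff, PS_derive, PS_plus, PS_scal.
    simpl. change plus with Rplus. change scal with Rmult. ring.
  - intros z Hz. rewrite Cmult_0_r, Cmod_0, Rplus_0_r.
    set (H := Cpseries (PS_derive (PS_derive a)) z).
    assert (Hc : forall n, PS_derive (PS_derive a) n = 2 * M).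
    { intros n. unfold PS_derive, a. rewrite extremal_coeff_SS. field.
      split; apply not_0_INR; lia. }
    assert (HT : is_series (K := C_AbsRing) (V := C_NormedModule)
                   (fun n => RtoC (2 * M) * Cpow z n)%C H).
    { apply (is_series_ext (V := C_NormedModule)) with (2 := taylor_coeffs_Cpseries _ HR2 z Hz).
      intros n. now rewrite Hc. }
    (* The geometric series: [H = 2 M + z H]. *)
    assert (HE : (H - 2 * M = z * H)%C).
    { apply (is_series_C_unique (fun n => RtoC (2 * M) * Cpow z (S n))%C).
      - apply (is_series_incr_1 (V := C_NormedModule) (fun n => RtoC (2 * M) * Cpow z n)%C).
        change (is_series (K := C_AbsRing) (V := C_NormedModule) (fun n => RtoC (2 * M) * Cpow z n)%C
          (H - 2 * M + RtoC (2 * M) * Cpow z 0)%C).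
        replace (H - 2 * M + RtoC (2 * M) * Cpow z 0)%C with H
          by (rewrite RtoC_mult; simpl Cpow; ring). exact HT.
      - apply (is_series_ext (V := C_NormedModule)) with (fun n => z * (RtoC (2 * M) * Cpow z n))%C.
        + intros n. rewrite Cpow_S. change (z * (RtoC (2 * M) * Cpow z n) = RtoC (2 * M) * (z * Cpow z n))%C. ring.
        + exact (is_series_scal (V := C_NormedModule) z _ _ HT). }
    rewrite <- HE. assert (Hz2 := Cmod2_alt z).
    assert (Hz3 : Re z ^ 2 + Im z ^ 2 < 1).
    { rewrite <- Hz2. assert (0 <= Cmod z) by apply Cmod_ge_0. simpl. nra. }
    clearbody H. destruct z as [x y], H as [p q]. injection HE as E1 E2. simpl in *.
    (* D = |1 - z|^2; multiplying H (1 - z) = 2 M by the conjugate of 1 - z gives p D = 2 M (1 - x),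
       and |z| < 1 amounts to D < 2 (1 - x). *)
    set (D := (1 - x) ^ 2 + y ^ 2).
    assert (HD : p * D = 2 * M * (1 - x)).
    { unfold D. assert (F1 : p - 2 * M = x * p - y * q) by lra.
      assert (F2 : q = x * q + y * p) by lra.
      replace (p * ((1 - x) ^ 2 + y ^ 2)) with ((1 - x) * (p - x * p) + y * (y * p)) by ring.
      replace (y * p) with (q - x * q) by lra.
      replace (p - x * p) with (2 * M - y * q) by lra. ring. }
    assert (Hx : x < 1) by nra.
    assert (HD0 : 0 < D) by (unfold D; nra).
    assert (HD1 : D < 2 * (1 - x)) by (unfold D; nra).
    assert (M < p); [|lra].
    apply Rmult_lt_reg_r with D; [exact HD0|]. rewrite HD. nra.
Qed.

(** * The harmonic class *)

Lemma rM_eq_increasing (M x y : R) : 0 < M -> 0 <= x < y -> y < 1 -> rM_eq M x < rM_eq M y.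
Proof.
  intros HM Hx Hy.
  destruct (MVT_cor2 (rM_eq M) (fun r => 2 - 4 * M * ln (1 - r)) x y) as (s & E & Hs); [lra| |].
  - intros r Hr. apply is_derive_Reals. unfold rM_eq. auto_derive; [lra|].
    change (1 + - r) with (1 - r). field. lra.
  - assert (Hl : ln (1 - s) < 0) by (rewrite <- ln_1; apply ln_increasing; lra).
    assert (0 < (2 - 4 * M * ln (1 - s)) * (y - x)); [|lra].
    apply Rmult_lt_0_compat; nra.
Qed.

Lemma ln_4 : ln 4 = 2 * ln 2.
Proof. replace 4 with (2 * 2) by ring. rewrite ln_mult by lra. ring. Qed.

(** The upper bound on M says that the limiting distance 1 + 2 M (1 - 2 ln 2) is positive. *)
Lemma two_M_ln_bound (M : R) : 0 < M < 1 / (2 * (ln 4 - 1)) -> 2 * M * (2 * ln 2 - 1) < 1.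
Proof.
  rewrite ln_4. intros [HM H]. assert (Hl := ln_lt_2).
  apply Rmult_lt_compat_r with (r := 2 * (2 * ln 2 - 1)) in H; [|lra].
  replace (1 / (2 * (2 * ln 2 - 1)) * (2 * (2 * ln 2 - 1))) with 1 in H by (field; lra). lra.
Qed.

(** Intermediate values on [0, 1/2], away from the singularity of ln (1 - r) at 1, give a root;
    strict monotonicity makes it unique. *)
Lemma rM_exists_unique (M : R) : 0 < M < 1 / (2 * (ln 4 - 1)) ->
  exists! r : R, (0 < r < 1) /\ rM_eq M r = 0.
Proof.
  intros hM. assert (HM := proj1 hM). assert (Hb := two_M_ln_bound M hM).
  assert (H0 : rM_eq M 0 < 0) by (unfold rM_eq; rewrite Rminus_0_r, ln_1; lra).
  (* At [r = 1/2] the left-hand side is [2 M ln 2]. *)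
  assert (H1 : 0 < rM_eq M (/ 2)).
  { unfold rM_eq. replace (1 - / 2) with (/ 2) by field. rewrite ln_Rinv by lra.
    assert (Hl := ln_lt_2). nra. }
  destruct (IVT_interv (rM_eq M) 0 (/ 2)) as (r & Hr & E); [|lra|assumption|assumption|].
  - intros r Hr. apply derivable_continuous_pt, ex_derive_Reals_0. unfold rM_eq. auto_derive. lra.
  - assert (r <> 0) by (intros ->; lra).
    exists r. split; [split; [lra|exact E]|]. intros s [Hs Es].
    destruct (Rtotal_order r s) as [Hlt|[Heq|Hlt]]; [|exact Heq|].
    + assert (HH := rM_eq_increasing M r s HM). lra.
    + assert (HH := rM_eq_increasing M s r HM). lra.
Qed.

(** * The distance to the boundary as a lower limit *)

(** By continuity each L(1) - e bounds |f(z) - f(0)| from below near the unit circle, so it belongs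
    to the set whose supremum is the distance; L may fail to be monotone. *)
Lemma dist_bd_ge (f : C -> C) (L : R -> R) : continuity_pt L 1 ->
  (forall z, Cmod z < 1 -> L (Cmod z) <= Cmod (f z - f (RtoC 0))) ->
  Rbar_le (L 1) (dist_bd f).
Proof.
  intros HL Hf. unfold dist_bd.
  match goal with |- Rbar_le _ (Lub_Rbar ?E) => destruct (Lub_Rbar_correct E) as [Hub _] end.
  assert (H : forall e, 0 < e -> exists r, r < 1 /\
            forall z : C, r < Cmod z < 1 -> L 1 - e <= Cmod (f z - f (RtoC 0))).
  { intros e He. destruct (HL e He) as (d & Hd & Hd').
    exists (1 - d). split; [lra|]. intros z Hz.
    specialize (Hf z (proj2 Hz)).
    assert (HD : Rabs (L (Cmod z) - L 1) < e).
    { apply Hd'. split; [split; [exact I|lra]|]. simpl. unfold Rdist. rewrite Rabs_left; lra. }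
    apply Rabs_lt_between in HD. lra. }
  match goal with |- Rbar_le _ ?D => set (D0 := D) in *; destruct D0 as [D1| |] eqn:ED end; simpl.
  - apply le_epsilon. intros e He. specialize (Hub (L 1 - e) (H e He)). simpl in Hub. lra.
  - exact I.
  - exact (Hub (L 1 - 1) (H 1 Rlt_0_1)).
Qed.

(** A single point on each circle caps every eventual lower bound m by L(t), and t tends to 1. *)
Lemma dist_bd_le (f : C -> C) (L : R -> R) : continuity_pt L 1 ->
  (forall t, 0 < t < 1 -> exists z, Cmod z = t /\ Cmod (f z - f (RtoC 0)) = L t) ->
  Rbar_le (dist_bd f) (L 1).
Proof.
  intros HL Hf. apply Lub_Rbar_correct. intros m (r & Hr & Hm). simpl.
  (* The radius r in the definition of the distance may be negative. *)
  assert (Hr0 := Rmax_l r 0). assert (Hr1 := Rmax_r r 0).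
  apply (left_limit_ge L (Rmax r 0) 1); [apply Rmax_case; lra|exact HL|].
  intros t Ht. destruct (Hf t ltac:(lra)) as (z & Hz & <-). apply Hm. lra.
Qed.

(** * Coefficient and modulus estimates by rotation *)

(** If k w = |w| with k unimodular, then conj w = k |w| = k^2 w. *)
Lemma exists_conj_rotation (w : C) : exists e : C, Cmod e = 1 /\ (e * w)%C = Cconj w.
Proof.
  destruct (exists_unit_rotation w) as (k & Hk & Hkw).
  exists (k * k)%C. split; [rewrite Cmod_mult, Hk; ring|].
  assert (Hw : w = (Cconj k * Cmod w)%C).
  { rewrite <- Hkw, Cmult_assoc, Cconj_mul_unit by exact Hk. now rewrite Cmult_1_l. }
  rewrite Hw at 2. rewrite Cmult_conj, Cconj_conj, <- Cmult_assoc, Hkw. f_equal.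
  unfold Cconj, RtoC; simpl. f_equal. ring.
Qed.

(** With k x = |x| and l y = |y|, the choice e = (conj k) l turns k (x + e y) into |x| + |y|. *)
Lemma exists_aligning_rotation (x y : C) :
  exists e : C, Cmod e = 1 /\ Cmod (x + e * y) = Cmod x + Cmod y.
Proof.
  destruct (exists_unit_rotation x) as (k & Hk & Hkx).
  destruct (exists_unit_rotation y) as (l & Hl & Hly).
  exists (Cconj k * l)%C. split; [rewrite Cmod_mult, Cmod_conj, Hk, Hl; ring|].
  rewrite <- (Rmult_1_l (Cmod (x + _))), <- Hk, <- Cmod_mult.
  replace (k * (x + Cconj k * l * y))%C with (k * x + Cconj k * k * (l * y))%C by ring.
  rewrite Cconj_mul_unit by exact Hk. rewrite Cmult_1_l, Hkx, Hly, <- RtoC_plus, Cmod_R.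
  apply Rabs_pos_eq. assert (H := Cmod_ge_0 x). assert (H' := Cmod_ge_0 y). lra.
Qed.

Lemma PH0_coeff_bound (M : R) (h g : C -> C) (a b : nat -> C) (n : nat) : 0 < M ->
  in_PH0 M h g -> taylor_coeffs h a -> taylor_coeffs g b ->
  Cmod (a (n + 2)%nat) + Cmod (b (n + 2)%nat) <= 2 * M * log_coeff (n + 2).
Proof.
  intros HM Hf Ha Hb. replace (n + 2)%nat with (S (S n)) by lia.
  destruct (exists_aligning_rotation (a (S (S n))) (b (S (S n)))) as (e & He & <-).
  assert (H := half_plane_class_coeff_bound M _ _ n HM (half_plane_class_rotate M h g e Hf He)
                 (taylor_coeffs_plus_scal h g a b e Ha Hb)).
  cbv beta in H. unfold log_coeff.
  assert (P : 0 < INR (S n) * INR (S (S n))) by (apply Rmult_lt_0_compat; apply lt_0_INR; lia).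
  apply Rmult_le_reg_l with (INR (S n) * INR (S (S n))); [exact P|].
  replace (INR (S n) * INR (S (S n)) * (2 * M * / (INR (S n) * INR (S (S n))))) with (2 * M)
    by (field; split; apply not_0_INR; lia). exact H.
Qed.

Lemma ex_series_log_coeff (r : R) : 0 <= r < 1 -> ex_series (fun n => log_coeff n * r ^ n).
Proof.
  intros Hr. apply (proj1 (ex_pseries_R _ _)), CV_radius_inside.
  apply Rbar_lt_le_trans with (2 := CV_radius_log_coeff). simpl. rewrite Rabs_pos_eq; lra.
Qed.

Lemma Series_log_coeff_shift (r : R) : 0 <= r < 1 ->
  is_series (fun n => log_coeff (n + 2) * r ^ (n + 2)) (r + (1 - r) * ln (1 - r)).
Proof.
  intros Hr. assert (Hr' : Rabs r < 1) by (rewrite Rabs_pos_eq; lra).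
  rewrite <- PSeries_log_coeff by exact Hr'.
  apply (is_series_ext (V := R_NormedModule)) with (fun n => log_coeff (2 + n) * r ^ (2 + n)).
  - intros n. now rewrite Nat.add_comm.
  - apply (is_series_incr_n (V := R_NormedModule) (fun n => log_coeff n * r ^ n)); [lia|].
    change (is_series (fun n => log_coeff n * r ^ n)
              (PSeries log_coeff r + sum_n (fun n => log_coeff n * r ^ n) 1)).
    (* The coefficients of index 0 and 1 vanish, so the shift by two loses nothing. *)
    rewrite sum_n_Reals. simpl sum_f_R0. rewrite !Rmult_0_l, !Rplus_0_r.
    apply Series_correct, ex_series_log_coeff, Hr.
Qed.

Lemma PH0_majorant (M : R) (h g : C -> C) (a b : nat -> C) (r : R) : 0 < M -> 0 <= r < 1 ->
  in_PH0 M h g -> taylor_coeffs h a -> taylor_coeffs g b ->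
  let u := fun n => (Cmod (a (n + 2)%nat) + Cmod (b (n + 2)%nat)) * r ^ (n + 2) in
  ex_series u /\ Series u <= 2 * M * (r + (1 - r) * ln (1 - r)).
Proof.
  intros HM Hr Hf Ha Hb u.
  assert (HS := Series_log_coeff_shift r Hr).
  apply (is_series_scal (V := R_NormedModule) (2 * M)) in HS.
  change (is_series (fun n => 2 * M * (log_coeff (n + 2) * r ^ (n + 2)))
             (2 * M * (r + (1 - r) * ln (1 - r)))) in HS.
  assert (Hu : forall n, 0 <= u n <= 2 * M * (log_coeff (n + 2) * r ^ (n + 2))).
  { intros n. unfold u. assert (Hp : 0 <= r ^ (n + 2)) by (apply pow_le; lra). split.
    - apply Rmult_le_pos; [|exact Hp]. apply Rplus_le_le_0_compat; apply Cmod_ge_0.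
    - rewrite <- Rmult_assoc. apply Rmult_le_compat_r; [exact Hp|].
      now apply (PH0_coeff_bound M h g a b). }
  split.
  - apply (ex_series_le (V := R_CompleteNormedModule))
      with (fun n => 2 * M * (log_coeff (n + 2) * r ^ (n + 2))); [|now eexists; apply HS].
    intros n. change norm with Rabs. rewrite Rabs_pos_eq; apply Hu.
  - rewrite <- (is_series_unique _ _ HS). apply Series_le; [exact Hu|now eexists; apply HS].
Qed.

(** At the given z the conjugate of g(z) is a rotation e g(z), so f(z) is the value of an analytic
    function whose series is bounded term by term. *)
Lemma PH0_modulus_upper (M : R) (h g : C -> C) (a b : nat -> C) (z : C) : 0 < M -> Cmod z < 1 ->
  in_PH0 M h g -> taylor_coeffs h a -> taylor_coeffs g b ->
  Cmod (harm h g z) <= Cmod z +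
    Series (fun n => (Cmod (a (n + 2)%nat) + Cmod (b (n + 2)%nat)) * Cmod z ^ (n + 2)).
Proof.
  intros HM Hz Hf Ha Hb.
  destruct (PH0_majorant M h g a b (Cmod z) HM (conj (Cmod_ge_0 z) Hz) Hf Ha Hb) as [Hex _].
  destruct (exists_conj_rotation (g z)) as (e & He & Hez).
  unfold harm. rewrite <- Hez.
  assert (HF := half_plane_class_rotate M h g e Hf He).
  assert (Hc := taylor_coeffs_plus_scal h g a b e Ha Hb).
  destruct (half_plane_class_first_coeffs M _ _ HF Hc) as [Hc0 Hc1]. cbv beta in Hc0, Hc1.
  (* The first two entries use c_0 = 0 and c_1 = 1 for the coefficients of h + e g, whatever e
     is. *)
  set (B := fun n => match n with 0%nat => 0 | 1%nat => Cmod z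
             | _ => (Cmod (a n) + Cmod (b n)) * Cmod z ^ n end).
  assert (HBs : forall n, B (S (S n)) = (Cmod (a (n + 2)%nat) + Cmod (b (n + 2)%nat)) * Cmod z ^ (n + 2)).
  { intros n. replace (n + 2)%nat with (S (S n)) by lia. reflexivity. }
  assert (HBex2 : ex_series (fun n => B (S (S n)))).
  { revert Hex. apply ex_series_ext. intros n. symmetry. apply HBs. }
  assert (HBex1 : ex_series (fun n => B (S n))) by now apply ex_series_incr_1.
  assert (HBex : ex_series B) by now apply ex_series_incr_1.
  assert (H := Cmod_series_le _ _ B (Hc z Hz) HBex).
  rewrite (Series_incr_1 B HBex), (Series_incr_1 _ HBex1), (Series_ext _ _ HBs) in H.
  change (B 0%nat) with 0 in H. change (B 1%nat) with (Cmod z) in H.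
  rewrite Rplus_0_l in H. apply H. intros [|[|n]].
  - rewrite Hc0, Cmult_0_l, Cmod_0. apply Rle_refl.
  - rewrite Hc1, Cmult_1_l, Cpow_1_r. apply Rle_refl.
  - rewrite Cmod_mult, Cmod_pow. unfold B.
    apply Rmult_le_compat_r; [apply pow_le, Cmod_ge_0|].
    eapply Rle_trans; [apply Cmod_triangle|]. rewrite Cmod_mult, He. lra.
Qed.

(** After the same rotation at z, the growth estimate applies along the ray in direction conj k,
    where k z = |z|. *)
Lemma PH0_modulus_lower (M : R) (h g : C -> C) (a b : nat -> C) (z : C) : 0 < M -> Cmod z < 1 ->
  in_PH0 M h g -> taylor_coeffs h a -> taylor_coeffs g b ->
  Cmod z - 2 * M * ((1 + Cmod z) * ln (1 + Cmod z) - Cmod z) <=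
  Cmod (harm h g z - harm h g (RtoC 0)).
Proof.
  intros HM Hz Hf Ha Hb.
  assert (H0 : harm h g (RtoC 0) = RtoC 0).
  { destruct Hf as (h' & h'' & g' & g'' & _ & Hh & _ & Hg & _).
    unfold harm. rewrite Hh, Hg. unfold Cconj, RtoC, Cplus; simpl. f_equal; ring. }
  rewrite H0. unfold harm.
  destruct (exists_conj_rotation (g z)) as (e & He & Hez). rewrite <- Hez.
  destruct (exists_unit_rotation z) as (k & Hk & Hkz).
  assert (Hk' : Cmod (Cconj k) = 1) by now rewrite Cmod_conj.
  assert (H := half_plane_class_growth M _ _ (Cconj k) (Cmod z) HM
    (half_plane_class_rotate M h g e Hf He) (taylor_coeffs_plus_scal h g a b e Ha Hb) Hk'
    (conj (Cmod_ge_0 z) Hz)).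
  cbv beta in H.
  replace (Cmod z * Cconj k)%C with z in H
    by (rewrite <- Hkz, (Cmult_comm k z), <- Cmult_assoc, (Cmult_comm k), Cconj_mul_unit by exact Hk;
        ring).
  eapply Rle_trans; [exact H|]. eapply Rle_trans; [apply Rle_abs|].
  eapply Rle_trans; [apply re_le_Cmod|]. rewrite Cmod_mult, Cmod_conj, Hk', Rmult_1_l.
  right. f_equal. ring.
Qed.

Lemma continuity_pt_growth (M : R) :
  continuity_pt (fun t => t - 2 * M * ((1 + t) * ln (1 + t) - t)) 1.
Proof. apply derivable_continuous_pt, ex_derive_Reals_0. auto_derive. lra. Qed.

Lemma taylor_coeffs_0 : taylor_coeffs (fun _ => RtoC 0) (fun _ => RtoC 0).
Proof.
  intros z _. apply is_series_C_iff.
  assert (Hr : Rabs 0 < 1) by (rewrite Rabs_R0; lra).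
  assert (H := is_series_scal (V := R_NormedModule) 0 _ _ (is_series_geom 0 Hr)).
  change (is_series (fun n => 0 * 0 ^ n) (0 * / (1 - 0))) in H. rewrite Rmult_0_l in H.
  split; apply (is_series_ext (V := R_NormedModule)) with (2 := H); intros n;
    rewrite Cmult_0_l; apply Rmult_0_l.
Qed.

(** * Sharpness of the radius and the final comparison *)

Lemma extremal_not_bohr (M rM r : R) : 0 < M < 1 / (2 * (ln 4 - 1)) ->
  0 < rM < 1 -> rM_eq M rM = 0 -> rM < r < 1 ->
  ~ bohr_ineq (harm (Cpseries (extremal_coeff M)) (fun _ => RtoC 0))
      (fun n => RtoC (extremal_coeff M n)) (fun _ => RtoC 0) (RtoC r).
Proof.
  intros hM HrM0 HrM Hr [_ H]. assert (HM := proj1 hM). assert (Hb := two_M_ln_bound M hM).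
  set (f := harm _ _) in H.
  assert (Hf : forall x, Rabs x < 1 -> f (RtoC x) = RtoC (x + 2 * M * (x + (1 - x) * ln (1 - x)))).
  { intros x Hx. unfold f, harm. rewrite Cpseries_real, PSeries_extremal_coeff by exact Hx.
    unfold Cconj, RtoC, Cplus; simpl. f_equal; ring. }
  assert (HD : Rbar_le (dist_bd f) (Rabs (1 - 2 * M * ((1 + 1) * ln (1 + 1) - 1)))).
  { apply (dist_bd_le f (fun t => Rabs (t - 2 * M * ((1 + t) * ln (1 + t) - t)))).
    - apply (continuity_pt_comp (fun t => t - 2 * M * ((1 + t) * ln (1 + t) - t)) Rabs).
      + apply continuity_pt_growth.
      + apply Rcontinuity_abs.
    (* On the negative axis f_M attains the growth bound: f_M(-t) = - (t - 2 M ((1 + t) ln (1 + t) -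
       t)). *)
    - intros t Ht. exists (RtoC (- t)). split.
      + rewrite Cmod_R, Rabs_left; lra.
      + rewrite !Hf by (rewrite ?Rabs_R0, ?Rabs_Ropp, ?(Rabs_pos_eq t); lra).
        rewrite <- RtoC_minus, Cmod_R, <- Rabs_Ropp. f_equal.
        rewrite Rminus_0_r, ln_1. replace (1 - - t) with (1 + t) by ring. ring. }
  assert (HS : Series (fun n => (Cmod (RtoC (extremal_coeff M (n + 2))) + Cmod (RtoC 0)) *
                 Cmod (RtoC r) ^ (n + 2)) = 2 * M * (r + (1 - r) * ln (1 - r))).
  { apply is_series_unique.
    assert (HL := is_series_scal (V := R_NormedModule) (2 * M) _ _
                   (Series_log_coeff_shift r ltac:(lra))).
    revert HL. apply (is_series_ext (V := R_NormedModule)). intros n.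
    rewrite Cmod_0, Rplus_0_r, !Cmod_R, (Rabs_pos_eq r) by lra.
    replace (n + 2)%nat with (S (S n)) by lia. rewrite extremal_coeff_SS.
    assert (P : 0 < INR (S n) * INR (S (S n))) by (apply Rmult_lt_0_compat; apply lt_0_INR; lia).
    rewrite Rabs_pos_eq by (apply Rdiv_le_0_compat; lra).
    symmetry. apply Rmult_assoc. }
  (* Beyond the root [rM_eq] is positive, so at z = r the left-hand side 2 r + 4 M (r + (1 - r) ln
     (1 - r)) exceeds the distance. *)
  assert (HI := rM_eq_increasing M rM r HM ltac:(lra) (proj2 Hr)).
  rewrite HrM in HI. unfold rM_eq in HI.
  assert (H' := Rbar_le_trans _ _ _ H HD). rewrite HS in H'. simpl in H'.
  rewrite Hf, !Cmod_R in H' by (rewrite Rabs_pos_eq; lra).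
  assert (Ha := Rle_abs (r + 2 * M * (r + (1 - r) * ln (1 - r)))).
  replace (1 + 1) with 2 in H' by ring.
  (* [Hb] makes the limiting distance positive, which removes its absolute value. *)
  rewrite (Rabs_pos_eq r), (Rabs_pos_eq (1 - _)) in H' by lra. lra.
Qed.

Theorem theorem2p1 (M : R) (hM : 0 < M < 1 / (2 * (ln 4 - 1))) :
  (exists! r : R, (0 < r < 1) /\ rM_eq M r = 0) /\
  forall rM : R, 0 < rM < 1 -> rM_eq M rM = 0 ->
    (forall (h g : C -> C) (a b : nat -> C),
        in_PH0 M h g -> taylor_coeffs h a -> taylor_coeffs g b ->
        forall z : C, Cmod z <= rM -> bohr_ineq (harm h g) a b z) /\
    (forall r : R, rM < r < 1 ->
        exists (h g : C -> C) (a b : nat -> C),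
          in_PH0 M h g /\ taylor_coeffs h a /\ taylor_coeffs g b /\
          exists z : C, Cmod z <= r /\ ~ bohr_ineq (harm h g) a b z).
Proof.
  assert (HM := proj1 hM).
  split; [now apply rM_exists_unique|]. intros rM HrM0 HrM. split.
  - intros h g a b Hf Ha Hb z Hz.
    assert (Hz0 := Cmod_ge_0 z).
    destruct (PH0_majorant M h g a b (Cmod z) HM ltac:(lra) Hf Ha Hb) as [Hex HS].
    split; [exact Hex|].
    assert (Hup := PH0_modulus_upper M h g a b z HM ltac:(lra) Hf Ha Hb).
    assert (Hd := dist_bd_ge (harm h g) _ (continuity_pt_growth M)
      (fun w Hw => PH0_modulus_lower M h g a b w HM Hw Hf Ha Hb)).
    apply Rbar_le_trans with (2 := Hd). simpl.
    (* The coefficient sum enters twice, directly and through the bound on |f(z)|, so the majorant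
       is 2 |z| + 4 M (|z| + (1 - |z|) ln (1 - |z|)); [HF] places it below the limiting distance. *)
    assert (HF : rM_eq M (Cmod z) <= 0).
    { destruct Hz as [Hz|Hz]; [|rewrite Hz; lra].
      assert (HI := rM_eq_increasing M (Cmod z) rM HM). lra. }
    unfold rM_eq in HF. replace (1 + 1) with 2 by ring. lra.
  - intros r Hr.
    exists (Cpseries (extremal_coeff M)), (fun _ => RtoC 0),
      (fun n => RtoC (extremal_coeff M n)), (fun _ => RtoC 0).
    split; [now apply extremal_in_PH0|].
    split; [now apply taylor_coeffs_Cpseries, CV_radius_extremal_coeff|].
    split; [exact taylor_coeffs_0|].
    exists (RtoC r). split.
    + rewrite Cmod_R, Rabs_pos_eq; lra.
    + now apply (extremal_not_bohr M rM).
Qed.
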